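(* Let $G$ be the joint distribution of $(Y,\mathbf{X})$, $Y\in\mathbb{R}$, $\mathbf{X}\in\mathbb{R}^p$ random with mean $\bm{\mu}$ and positive definite covariance $\bm{\Sigma}$, following the single-index model $Y=f(\bm{\beta}^\top\mathbf{X},\varepsilon)$ with $\bm{\beta}\neq\mathbf{0}$, $\varepsilon$ independent of $\mathbf{X}$, $E(\varepsilon)=0$. Assume (i) for every $\bm{b}\in\mathbb{R}^p$ there are constants $a_0,a_1$ with $E(\bm{b}^\top\mathbf{X}\mid\bm{\beta}^\top\mathbf{X})=a_0+a_1\bm{\beta}^\top\mathbf{X}$, and (ii) $\mathrm{Var}(\mathbf{X}\mid\bm{\beta}^\top\mathbf{X})$ is constant. With the SWAR e.d.r. direction functional $\gamma_1$ and its influence function as described in the context, the asymptotic variance $\mathrm{ASV}(\gamma_1,G)=E_G[\mathrm{IF}(\gamma_1,\bm{W};G)\,\mathrm{IF}(\gamma_1,\bm{W};G)^\top]$, with $\bm{W}=(Y,\mathbf{X})\sim G$, equals $$\mathrm{ASV}(\gamma_1,G)=\frac{1}{\lambda_1^2}\sum_{h=1}^H w_h(\bm{b}_h^\top\bm{\gamma}_1)^2\,E(R_h^2\mid Y\in S_h)\,(\bm{I}-\bm{P})\bm{\Sigma}^{-1}(\bm{I}-\bm{P}),$$ where $R_h=Y-E(Y\mid Y\in S_h)-\bm{b}_h^\top(\mathbf{X}-\bm{\mu}_h)$ and $\bm{P}=\bm{\gamma}_1\bm{\gamma}_1^\top$.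
   Context: Slices: $S_1,\dots,S_H$ are non-overlapping subranges partitioning the range of $Y$, with $w_h=P_G(Y\in S_h)>0$. $\bm{\mu}_h=E_G(\mathbf{X}\mid Y\in S_h)$, $\bm{\Sigma}_h=\mathrm{Var}_G(\mathbf{X}\mid Y\in S_h)$ (nonsingular), $\bm{b}_h=\bm{\Sigma}_h^{-1}\mathrm{Cov}_G(\mathbf{X},Y\mid Y\in S_h)$, SWAR matrix $R(G)=\sum_h w_h\bm{b}_h\bm{b}_h^\top$. The functional $\gamma_1$ maps a distribution to the unit eigenvector of its SWAR matrix for the largest eigenvalue; $\bm{\gamma}_1=\gamma_1(G)$, $\lambda_1>0$ the largest eigenvalue of $R(G)$. For a point $\bm{w}_0=(y_0,\bm{x}_0)$, $G_\varepsilon=(1-\varepsilon)G+\varepsilon\Delta_{\bm{w}_0}$ ($\Delta_{\bm{w}_0}$ point mass), slices under $G_\varepsilon$ are chosen to keep the pre-determined slicing proportions $w_1,\dots,w_H$ (independent of the distribution), and $\mathrm{IF}(\gamma_1,\bm{w}_0;G)=\lim_{\varepsilon\downarrow0}[\gamma_1(G_\varepsilon)-\gamma_1(G)]/\varepsilon$. *)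

(* Defs.v *)
From HB Require Import structures.
From mathcomp Require Import all_boot all_order all_algebra.
From mathcomp Require Import all_classical all_reals all_analysis.
Unset Printing Implicit Defensive.
Import Order.TTheory GRing.Theory Num.Theory.
Import numFieldNormedType.Exports.
Local Open Scope classical_set_scope.
Local Open Scope ring_scope.

(* A (joint) distribution of W = (Y, X) on R x R^p is represented by its
   expectation operator  phi |-> E[phi(Y, X)]. *)
Definition expop (R : realType) (p : nat) := (R -> 'cV[R]_p -> R) -> R.

Section Slices.
Variables (R : realType) (p : nat).

(* H slices given by boundaries q 0 < q 1 < ... < q (H-2):
   S_0 = (-oo, q 0], S_h = (q (h-1), q h], S_(H-1) = (q (H-2), +oo). *)
Definition in_slice (H : nat) (q : nat -> R) (h : 'I_H) (y : R) : bool :=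
  ((nat_of_ord h == 0%N) || (q (nat_of_ord h).-1 < y)) &&
  (((nat_of_ord h).+1 == H) || (y <= q (nat_of_ord h))).

Definition slice_ind H q (h : 'I_H) (y : R) : R := (in_slice H q h y)%:R.

Variable E : expop R p.
Variables (H : nat) (q : nat -> R).

Definition sl_w (h : 'I_H) : R := E (fun y _ => slice_ind H q h y).
Definition sl_muY (h : 'I_H) : R :=
  (sl_w h)^-1 * E (fun y _ => slice_ind H q h y * y).
Definition sl_mu (h : 'I_H) : 'cV[R]_p :=
  (sl_w h)^-1 *: \col_i E (fun y x => slice_ind H q h y * x i 0).
Definition sl_Sigma (h : 'I_H) : 'M[R]_p :=
  (sl_w h)^-1 *: \matrix_(i, j) E (fun y x => slice_ind H q h y *
       ((x i 0 - sl_mu h i 0) * (x j 0 - sl_mu h j 0))).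
Definition sl_cov (h : 'I_H) : 'cV[R]_p :=
  (sl_w h)^-1 *: \col_i E (fun y x => slice_ind H q h y *
       ((x i 0 - sl_mu h i 0) * (y - sl_muY h))).
Definition sl_b (h : 'I_H) : 'cV[R]_p := invmx (sl_Sigma h) *m sl_cov h.
Definition swar : 'M[R]_p := \sum_(h < H) sl_w h *: (sl_b h *m (sl_b h)^T).
Definition sl_ER2 (h : 'I_H) : R :=
  (sl_w h)^-1 * E (fun y x => slice_ind H q h y *
       (y - sl_muY h - (((sl_b h)^T *m (x - sl_mu h)) 0 0)) ^+ 2).

Definition valid_slicing (w : 'I_H -> R) : Prop :=
  (forall i : nat, (i.+2 < H)%N -> q i < q i.+1) /\
  (forall h : 'I_H, sl_w h = w h).
End Slices.

Definition top_unit_eigvec (R : realType) (p : nat) (A : 'M[R]_p) (l : R)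
  (v : 'cV[R]_p) : Prop :=
  (v^T *m v) 0 0 = 1 /\ A *m v = l *: v /\
  (forall (m : R) (u : 'cV[R]_p), u != 0 -> A *m u = m *: u -> m <= l).

Definition mixexp (R : realType) (p : nat) (E : expop R p) (e y0 : R)
  (x0 : 'cV[R]_p) : expop R p :=
  fun phi => (1 - e) * E phi + e * phi y0 x0.

Section Law.
Variables (R : realType) (d : measure_display) (T : measurableType d).
Variables (P : probability T R) (p : nat).

Definition law_exp (Y : T -> R) (X : T -> 'cV[R]_p) : expop R p :=
  fun phi => Rintegral P setT (fun w => phi (Y w) (X w)).

Definition law_mean Y X : 'cV[R]_p := \col_i law_exp Y X (fun _ x => x i 0).
Definition law_cov Y X : 'M[R]_p :=
  \matrix_(i, j) law_exp Y X (fun _ x =>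
     (x i 0 - law_mean Y X i 0) * (x j 0 - law_mean Y X j 0)).

Definition is_condexp (Z U : T -> R) (g : R -> R) : Prop :=
  measurable_fun setT g /\
  P.-integrable setT (EFin \o U) /\
  P.-integrable setT (EFin \o (g \o Z)) /\
  (forall A : set R, measurable A ->
     (\int[P]_(w in Z @^-1` A) (U w)%:E = \int[P]_(w in Z @^-1` A) (g (Z w))%:E)%E).

(* independence of the real r.v. e and the random vector X
   (checked on the generating pi-system of rectangles of R^p) *)
Definition indep_vec (e : T -> R) (X : T -> 'cV[R]_p) : Prop :=
  forall (A : set R) (B : 'I_p -> set R), measurable A ->
    (forall i, measurable (B i)) ->
    P (e @^-1` A `&` [set w | forall i, B i (X w i ord0)]) =
    (P (e @^-1` A) * P [set w | forall i, B i (X w i ord0)])%E.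
End Law.

Arguments in_slice {R} H q h y.
Arguments slice_ind {R} H q h y.
Arguments sl_w {R p} E H q h.
Arguments sl_muY {R p} E H q h.
Arguments sl_mu {R p} E H q h.
Arguments sl_Sigma {R p} E H q h.
Arguments sl_cov {R p} E H q h.
Arguments sl_b {R p} E H q h.
Arguments swar {R p} E H q.
Arguments sl_ER2 {R p} E H q h.
Arguments valid_slicing {R p} E H q w.
Arguments top_unit_eigvec {R p} A l v.
Arguments mixexp {R p} E e y0 x0 phi.
Arguments law_exp {R d T} P {p} Y X phi.
Arguments law_mean {R d T} P {p} Y X.
Arguments law_cov {R d T} P {p} Y X.
Arguments is_condexp {R d T} P Z U g.
Arguments indep_vec {R d T} P {p} e X.

(* Main.v *)
Require Import Defs.
From HB Require Import structures.
From mathcomp Require Import all_boot all_order all_algebra.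
From mathcomp Require Import all_classical all_reals all_analysis.
From mathcomp Require Import measurable_realfun ring lra.
Import Order.TTheory GRing.Theory Num.Theory.
Import numFieldNormedType.Exports.
Local Open Scope classical_set_scope.
Local Open Scope ring_scope.

(** Write [Z = beta^T X], [mu = E X] and [Sig = Var X].  If [b^T Sig beta = 0], the
    linearity and constant variance conditions give [E(b^T (X - mu) | Z) = 0] and
    [E((b^T (X - mu))^2 | Z) = b^T Sig b]; as [eps] is independent of [X], both still
    hold after conditioning on [(Z, eps)], hence on [(Y, Z)].  Consequently moving
    the slice boundaries perturbs the within-slice normal equations only along
    [beta].  For [a] orthogonal to [beta] and [b = Sig^-1 a], the normal equations at
    the contaminated distribution therefore become, exactly,
      [(w_h - e 1_{S_h}(y0)) a^T b_h(e) = e 1_{S_h}(y0) r_h(e) b^T (x0 - mu)],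
    with [r_h(e)] the residual of the point [(y0, x0)] in the contaminated slice.
    No regularity of the law of [Y] is needed: the slice containing [y0] cannot
    change, and the boundaries move by a probability of order [e], so all slice
    moments converge.  Inserting this in the eigenvalue equation and letting [e] go
    to [0] gives
      [IF = lam1^-1 (sum_h 1_{S_h}(y0) r_h (b_h^T g)) (1 - P) Sig^-1 (x0 - mu)],
    in which the scalar factor is a function of [(Y, Z)], so that [E (IF IF^T)]
    factors by the second conditional identity. *)

(** * Integrable and square-integrable random variables, and real-valued expectation *)

Section Expectation.
Context {R : realType} {d : measure_display} {T : measurableType d}.
Variable P : probability T R.
Implicit Types f g h U : T -> R.

Definition L1 f : Prop := P.-integrable setT (EFin \o f).
Definition Ex f : R := Rintegral P setT f.
Definition L2 f : Prop := measurable_fun setT f /\ L1 (fun t => f t ^+ 2).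

Lemma L1_meas f : L1 f -> measurable_fun setT f.
Proof. by move=> /integrableP[/measurable_EFinP]. Qed.

Lemma L1_le f g : measurable_fun setT f -> L1 g ->
  (forall t, `|f t| <= g t) -> L1 f.
Proof.
move=> mf ig fg; apply: (le_integrable _ _ _ ig) => //.
  exact/measurable_EFinP.
by move=> x _; rewrite lee_fin (le_trans (fg x))// ler_norm.
Qed.

Lemma L1_cst c : L1 (fun=> c).
Proof. exact: finite_measure_integrable_cst. Qed.

Lemma L1D f g : L1 f -> L1 g -> L1 (fun t => f t + g t).
Proof. by move=> f1 g1; exact: (integrableD measurableT f1 g1). Qed.

Lemma L1Z c f : L1 f -> L1 (fun t => c * f t).
Proof. by move=> f1; exact: (integrableZl measurableT c f1). Qed.

Lemma L1B f g : L1 f -> L1 g -> L1 (fun t => f t - g t).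
Proof. by move=> f1 g1; exact: (integrableB measurableT f1 g1). Qed.

Lemma L1_sum (I : Type) (s : seq I) (F : I -> T -> R) :
  (forall i, L1 (F i)) -> L1 (fun t => \sum_(i <- s) F i t).
Proof.
move=> F1; elim: s => [|i s ih].
  by under [fun _ => _]eq_fun do rewrite big_nil; exact: L1_cst.
by under [fun _ => _]eq_fun do rewrite big_cons; apply: L1D.
Qed.

Lemma L1_bdM h f c : measurable_fun setT h -> (forall t, `|h t| <= c) ->
  L1 f -> L1 (fun t => h t * f t).
Proof.
move=> mh hc f1; apply: (@L1_le _ (fun t => c * `|f t|)).
- by apply: measurable_funM => //; exact: L1_meas.
- by apply: L1Z; exact: (integrable_norm f1).
- by move=> t; rewrite normrM ler_wpM2r.
Qed.

(** Domination of $|fg|$ by $f^2 + g^2$. *)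
Lemma L2_mulL1 f g : L2 f -> L2 g -> L1 (fun t => f t * g t).
Proof.
move=> [mf f2] [mg g2]; apply: (L1_le _ _ _ (L1D _ _ f2 g2)).
  exact: measurable_funM.
by move=> t; rewrite ler_norml; apply/andP; split; nra.
Qed.

Lemma L2_cst c : L2 (fun=> c).
Proof. by split; [exact: measurable_cst|exact: L1_cst]. Qed.

Lemma L2_L1 f : L2 f -> L1 f.
Proof.
move=> f2; have := L2_mulL1 _ _ f2 (L2_cst 1).
by under [fun _ => _]eq_fun do rewrite mulr1.
Qed.

Lemma L2D f g : L2 f -> L2 g -> L2 (fun t => f t + g t).
Proof.
move=> f2 g2; split; first by apply: measurable_funD; [case: f2|case: g2].
under [fun _ => _]eq_fun do rewrite sqrrD mulr2n.
have fg := L2_mulL1 _ _ f2 g2.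
by apply: L1D; [apply: L1D; [exact: f2.2|exact: L1D]|exact: g2.2].
Qed.

Lemma L2Z c f : L2 f -> L2 (fun t => c * f t).
Proof.
move=> [mf f2]; split; first exact: measurable_funM.
by under [fun _ => _]eq_fun do rewrite exprMn; exact: L1Z.
Qed.

Lemma L2B f g : L2 f -> L2 g -> L2 (fun t => f t - g t).
Proof.
move=> f2 g2; under [fun _ => _]eq_fun do rewrite -mulN1r.
by apply: L2D => //; exact: L2Z.
Qed.

Lemma L2_sum (I : Type) (s : seq I) (F : I -> T -> R) :
  (forall i, L2 (F i)) -> L2 (fun t => \sum_(i <- s) F i t).
Proof.
move=> F1; elim: s => [|i s ih].
  by under [fun _ => _]eq_fun do rewrite big_nil; exact: L2_cst.
by under [fun _ => _]eq_fun do rewrite big_cons; apply: L2D.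
Qed.

Lemma L2_bdM h f c : measurable_fun setT h -> (forall t, `|h t| <= c) ->
  L2 f -> L2 (fun t => h t * f t).
Proof.
move=> mh hc [mf f2]; split; first exact: measurable_funM.
under [fun _ => _]eq_fun do rewrite exprMn.
apply: (@L1_bdM _ _ (c ^+ 2)) => //; first exact: measurable_funX.
by move=> t; rewrite normrX lerXn2r// ?nnegrE// (le_trans _ (hc t)).
Qed.

Lemma Ex_cst c : Ex (fun=> c) = c.
Proof. by rewrite /Ex Rintegral_cst//= probability_setT mulr1. Qed.

Lemma ExD f g : L1 f -> L1 g -> Ex (fun t => f t + g t) = Ex f + Ex g.
Proof. by move=> f1 g1; rewrite /Ex RintegralD. Qed.

Lemma ExB f g : L1 f -> L1 g -> Ex (fun t => f t - g t) = Ex f - Ex g.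
Proof. by move=> f1 g1; rewrite /Ex RintegralB. Qed.

Lemma ExZ c f : L1 f -> Ex (fun t => c * f t) = c * Ex f.
Proof. by move=> f1; rewrite /Ex RintegralZl. Qed.

Lemma Ex_sum (I : Type) (s : seq I) (F : I -> T -> R) :
  (forall i, L1 (F i)) ->
  Ex (fun t => \sum_(i <- s) F i t) = \sum_(i <- s) Ex (F i).
Proof.
move=> F1; elim: s => [|i s ih].
  by under [fun _ => _]eq_fun do rewrite big_nil; rewrite Ex_cst big_nil.
under [fun _ => _]eq_fun do rewrite big_cons.
by rewrite ExD ?ih ?big_cons//; exact: L1_sum.
Qed.

Lemma le_Ex f g : L1 f -> L1 g -> (forall t, f t <= g t) -> Ex f <= Ex g.
Proof. by move=> f1 g1 fg; exact: le_Rintegral. Qed.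

Lemma Ex_EFin f : L1 f -> (Ex f)%:E = (\int[P]_t (f t)%:E)%E.
Proof. by move=> f1; rewrite /Ex /Rintegral fineK//; exact: integrable_fin_num. Qed.

Lemma ae_eq_Ex f g : L1 f -> measurable_fun setT g ->
  {ae P, forall t, f t = g t} -> L1 g /\ Ex f = Ex g.
Proof.
move=> f1 mg fg.
have mf := L1_meas _ f1.
split.
  apply/integrableP; split; first exact/measurable_EFinP.
  case/integrableP : f1 => _; congr (_ < _)%E.
  apply: ae_eq_integral => //.
  - by apply/measurable_EFinP; exact: measurableT_comp.
  - by apply/measurable_EFinP; exact: measurableT_comp.
  - by apply: filterS fg => t /= + _ => ->.
rewrite /Ex /Rintegral; congr fine; apply: ae_eq_integral => //.
- exact/measurable_EFinP.
- exact/measurable_EFinP.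
- by apply: filterS fg => t /= + _ => ->.
Qed.

Lemma Ex_mkcond (A : set T) f : measurable A -> L1 f ->
  (\int[P]_(t in A) (f t)%:E)%E = (Ex (fun t => \1_A t * f t))%:E.
Proof.
move=> mA f1; rewrite Ex_EFin; last first.
  apply: (@L1_bdM _ _ 1) => // t.
  by rewrite indicE ger0_norm// lern1 leq_b1.
rewrite integral_mkcond; apply: eq_integral => t _.
by rewrite /= patchE indicE; case: ifP; rewrite ?mul1r ?mul0r.
Qed.

End Expectation.

(** * From zero integrals on events of [W] to orthogonality to functions of [W] *)

Section OrthogonalToSigmaAlgebra.
Context {R : realType} {d d' : measure_display}.
Context {T : measurableType d} {T' : measurableType d'}.
Variables (P : probability T R) (W : T -> T') (U : T -> R).
Hypotheses (mW : measurable_fun setT W) (U1 : L1 P U).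

Let mWA A : measurable A -> measurable (W @^-1` A).
Proof. by move=> mA; rewrite -[X in measurable X]setTI; exact: mW. Qed.

(** The events of [W] on which [U] integrates to 0 form a Dynkin system: complements use the
    vanishing of the full integral, countable disjoint unions the integrability of [U]. The
    pi-lambda theorem concludes. *)
Lemma integral0_pi_system (G : set (set T')) :
  @measurable _ T' = <<s G >> -> setI_closed G ->
  (\int[P]_t (U t)%:E = 0)%E ->
  (forall A, G A -> \int[P]_(t in W @^-1` A) (U t)%:E = 0)%E ->
  (forall A, measurable A -> \int[P]_(t in W @^-1` A) (U t)%:E = 0)%E.
Proof.
move=> GE GI UT UG A mA; have : <<s G >> A by rewrite -GE.
move: A mA => A _; move: A.
pose Z S := (\int[P]_(t in W @^-1` S) (U t)%:E = 0)%E.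
apply: (@dynkin_induction _ T' G Z GE GI) => //; rewrite /Z.
- move=> S mS US.
  have := UT; rewrite -(setUv (W @^-1` S)) integral_setU//.
  - by rewrite US add0e.
  - exact: mWA.
  - by apply: measurableC; exact: mWA.
  - by rewrite setUv; exact: measurable_int U1.
  - by apply/disj_setPS => x [].
- move=> F mF tF UF; rewrite preimage_bigcup integral_bigcup//.
  + by apply: eseries0 => i _ _; exact: UF.
  + apply/trivIsetP => i j _ _ ij; rewrite -preimage_setI.
    by move/trivIsetP : tF => /(_ i j I I ij) ->; rewrite preimage_set0.
  + by move=> k; exact: mWA.
  + by apply: integrableS U1 => //; apply: bigcupT_measurable => k; exact: mWA.
Qed.

Hypothesis U0 : (forall A, measurable A -> \int[P]_(t in W @^-1` A) (U t)%:E = 0)%E.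

Import HBNNSimple.

(** Simple-function stage: [s] composed with [W] is a finite combination of indicators of events of
    [W], on each of which [U] integrates to 0. *)
Lemma Ex_orth_nnsfun (s : {nnsfun T' >-> R}) :
  L1 P (fun t => s (W t) * U t) /\ Ex P (fun t => s (W t) * U t) = 0.
Proof.
have K y : L1 P (fun t => \1_(W @^-1` (s @^-1` [set y])) t * U t).
  apply: (@L1_bdM _ _ _ _ _ _ 1) => //.
    by apply: measurable_indic; exact: mWA.
  by move=> t; rewrite indicE ger0_norm// lern1 leq_b1.
have E t : s (W t) * U t = \sum_(y \in range s)
   y * (\1_(W @^-1` (s @^-1` [set y])) t * U t).
  rewrite fimfunE mulr_fsuml; apply: eq_fsbigr => y _.
  by rewrite mulrA.
under [fun t => _]eq_fun do rewrite E fsbig_finite//=.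
split; first by apply: L1_sum => y; exact: L1Z.
rewrite Ex_sum; last by move=> y; exact: L1Z.
rewrite big1// => y _; rewrite ExZ//.
have := Ex_mkcond P (W @^-1` (s @^-1` [set y])) U
  (mWA _ (measurable_funPTI s (measurable_set1 y))) U1.
by rewrite U0// => -[<-]; rewrite mulr0.
Qed.

(** Dominated convergence along simple functions below [phi], with bound $|\phi(W) U|$. Hence [phi]
    may be unbounded as long as the product is integrable. *)
Lemma Ex_orth_ge0 (phi : T' -> R) : measurable_fun setT phi ->
  (forall y, 0 <= phi y) -> L1 P (fun t => phi (W t) * U t) ->
  Ex P (fun t => phi (W t) * U t) = 0.
Proof.
move=> mphi phi0 phiU1.
have mE : measurable_fun setT (EFin \o phi) by exact/measurable_EFinP.
pose s := nnsfun_approx measurableT mE.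
have sphi y : EFin \o s^~ y @ \oo --> (phi y)%:E.
  by apply: (cvg_nnsfun_approx measurableT mE) => // x _; rewrite lee_fin.
have sle n y : s n y <= phi y.
  rewrite -lee_fin /s nnsfun_approxE.
  by apply: (@le_approx _ T' R setT (EFin \o phi) n y) => // x _; rewrite lee_fin.
have [|||_ _] := @dominated_convergence _ T R P setT measurableT
  (fun n t => (s n (W t) * U t)%:E) (fun t => (phi (W t) * U t)%:E)
  (fun t => `|phi (W t) * U t|%:E)
  (fun n => measurable_int P (Ex_orth_nnsfun (s n)).1)
  (measurable_int P phiU1).
- apply: aeW => t _; under eq_fun do rewrite EFinM; rewrite EFinM.
  by apply: cvgeZr => //; exact: sphi.
- exact: (integrable_norm phiU1).
- apply: aeW => t n _; rewrite lee_fin !normrM ler_wpM2r//.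
  by rewrite !ger0_norm.
rewrite -Ex_EFin// => cv.
have : (Ex P (fun t => phi (W t) * U t))%:E = 0%:E.
  apply/esym/(cvg_unique _ _ cv) => //.
  apply: cvg_near_cst; apply: nearW => n /=.
  by rewrite -Ex_EFin ?(Ex_orth_nnsfun (s n)).2//; exact: (Ex_orth_nnsfun (s n)).1.
by move=> [].
Qed.

(** Splits [phi] into positive and negative parts; both are bounded by $|\phi|$, so each product
    with [U] stays integrable. *)
Lemma Ex_orth (phi : T' -> R) : measurable_fun setT phi ->
  L1 P (fun t => phi (W t) * U t) -> Ex P (fun t => phi (W t) * U t) = 0.
Proof.
move=> mphi phiU1.
have mU := L1_meas _ _ U1.
have mpos : measurable_fun setT (fun y => Num.max (phi y) 0) by exact: measurable_maxr.
have mneg : measurable_fun setT (fun y => Num.max (- phi y) 0).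
  by apply: measurable_maxr => //; exact: measurableT_comp.
have L (psi : T' -> R) : measurable_fun setT psi -> (forall y, `|psi y| <= `|phi y|) ->
    L1 P (fun t => psi (W t) * U t).
  move=> mpsi psile; apply: (@L1_le _ _ _ _ _ (fun t => `|phi (W t) * U t|)).
  - by apply: measurable_funM => //; exact: measurableT_comp.
  - exact: integrable_norm phiU1.
  - by move=> t; rewrite !normrM ler_wpM2r.
have Lp : L1 P (fun t => Num.max (phi (W t)) 0 * U t).
  apply: (L _ mpos) => y; case: (leP 0 (phi y)) => //= h.
  by rewrite normr0.
have Ln : L1 P (fun t => Num.max (- phi (W t)) 0 * U t).
  apply: (L _ mneg) => y; case: (leP (- phi y) 0) => //= h; last by rewrite normrN.
  by rewrite normr0.
have -> : (fun t => phi (W t) * U t) =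
    (fun t => Num.max (phi (W t)) 0 * U t - Num.max (- phi (W t)) 0 * U t).
  apply/funext => t; rewrite -mulrBl; congr (_ * _).
  by case: (leP (phi (W t)) 0) => h; case: (leP (- phi (W t)) 0) => h'; lra.
rewrite ExB// (Ex_orth_ge0 _ mpos) ?(Ex_orth_ge0 _ mneg) ?subrr// => y.
- by rewrite le_max lexx orbT.
- by rewrite le_max lexx orbT.
Qed.

End OrthogonalToSigmaAlgebra.

(** * Independence of [eps] and [X], and conditioning on an [X]-measurable variable together with
    [eps] *)

Section Independence.
Context {R : realType} {d : measure_display} {T : measurableType d} {p : nat}.
Variables (P : probability T R) (X : T -> 'cV[R]_p) (eps : T -> R).
Hypotheses (mX : forall i, measurable_fun setT (fun t => X t i 0))
  (meps : measurable_fun setT eps) (indep : indep_vec P eps X).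

Definition rectangles : set (set T) :=
  [set D | exists2 B : 'I_p -> set R, (forall i, measurable (B i)) &
           D = [set t | forall i, B i (X t i 0)]].

(** The set [T] with the sigma-algebra generated by the coordinates of [X]. Being a function of [X]
    is thus expressed as measurability on [TX]. *)
Definition TX := g_sigma_algebraType rectangles.

Definition sigmaX (V : T -> R) : Prop := measurable_fun (setT : set TX) V.

Lemma rectanglesI : setI_closed rectangles.
Proof.
move=> _ _ [B mB ->] [C mC ->]; exists (fun i => B i `&` C i).
  by move=> i; exact: measurableI.
apply/seteqP; split => t /=; first by move=> [b c] i; split.
by move=> bc; split => i; case: (bc i).
Qed.

Lemma rectangle_measurable A : rectangles A -> measurable A.
Proof.
move=> [B mB ->].
rewrite [X in measurable X](_ : _ = \bigcap_i ((fun t => X t i 0) @^-1` B i)).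
  apply: fin_bigcap_measurable => // i _; rewrite -[X in measurable X]setTI.
  exact: mX.
by apply/seteqP; split => t /=; [move=> h i _; exact: h|move=> h i; exact: h].
Qed.

Lemma measurable_idX : measurable_fun (setT : set T) (idfun : T -> TX).
Proof.
apply: (@measurability _ _ T TX _ _ rectangles) => //.
move=> _ [A GA <-]; rewrite setTI; exact: rectangle_measurable.
Qed.

Lemma sigmaX_meas V : sigmaX V -> measurable_fun setT V.
Proof. by move=> mV; apply: (measurableT_comp mV); exact: measurable_idX. Qed.

Lemma sigmaX_coord i : sigmaX (fun t => X t i 0).
Proof.
move=> _ A mA; rewrite setTI; apply: sub_sigma_algebra.
exists (fun j => if j == i then A else setT).
  by move=> j; case: ifP.
apply/seteqP; split => t /=; last by move=> /(_ i); rewrite eqxx.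
by move=> At j; case: eqP => // ->.
Qed.

(** The centred indicator [U] of the event that [eps] lies in [B] integrates to 0 over every
    rectangle, by independence. Rectangles form a pi-system, so [U] is orthogonal to every
    [X]-measurable [V]. *)
Lemma Ex_indep (V : T -> R) (B : set R) : measurable B -> sigmaX V -> L1 P V ->
  Ex P (fun t => \1_(eps @^-1` B) t * V t) =
  fine (P (eps @^-1` B)) * Ex P V.
Proof.
move=> mB sV V1.
have mEB : measurable (eps @^-1` B) by rewrite -[X in measurable X]setTI; exact: meps.
pose c := fine (P (eps @^-1` B)).
pose U t := \1_(eps @^-1` B) t - c : R.
have I1 : L1 P (\1_(eps @^-1` B) : T -> R) by exact: integrable_indic.
have Ib t : `|\1_(eps @^-1` B) t : R| <= 1.
  by rewrite indicE ger0_norm// lern1 leq_b1.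
have U1 : L1 P U by apply: L1B => //; exact: L1_cst.
have EI A : measurable A -> Ex P (\1_A : T -> R) = fine (P A).
  by move=> mA; rewrite /Ex /Rintegral integral_indic// setIT.
have ID : L1 P (fun t => \1_(eps @^-1` B) t * V t).
  by apply: (@L1_bdM _ _ _ _ _ _ 1) => //; exact: measurable_indic.
have UA A : measurable A -> P (eps @^-1` B `&` A) = (P (eps @^-1` B) * P A)%E ->
    (\int[P]_(t in A) (U t)%:E = 0)%E.
  move=> mA PA; rewrite Ex_mkcond//.
  have -> : (fun t => \1_A t * U t) = (fun t => \1_(eps @^-1` B `&` A) t - c * \1_A t).
    by apply/funext => t; rewrite /U indicI mulrBr mulrC [c * _]mulrC.
  rewrite ExB; [|exact/integrable_indic/measurableI|exact/L1Z/integrable_indic].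
  rewrite ExZ; last exact: integrable_indic.
  by rewrite !EI//; [rewrite PA fineM ?fin_num_measure// subrr|exact: measurableI].
(* With [W := idfun], viewed as a map into [TX], every [X]-measurable variable is a measurable
   function of [W]. *)
have := @Ex_orth _ _ _ T TX P idfun U measurable_idX U1 _ V sV.
have -> : (fun t => V (idfun t) * U t) = (fun t => \1_(eps @^-1` B) t * V t - c * V t).
  by apply/funext => t; rewrite /U mulrBr mulrC [V t * c]mulrC.
rewrite ExB ?ExZ//; last exact: L1Z.
move=> h; apply/eqP; rewrite -subr_eq0; apply/eqP/h; last by apply: L1B => //; exact: L1Z.
apply: (integral0_pi_system _ _ _ measurable_idX U1 rectangles) => //.
- exact: rectanglesI.
- by apply: UA => //; rewrite setIT probability_setT mule1.
- move=> A GA; apply: UA; first exact: rectangle_measurable.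
  by case: GA => C mC ->; exact: indep.
Qed.

(** Upgrades $E(V \mid Z) = 0$ to $E(V \mid Z, \varepsilon) = 0$. On a product event, independence
    factors out the probability that [eps] lies in [B] and leaves the integral of [V] over an event
    of [Z], which is 0; product sets are a generating pi-system. *)
Lemma Ex_cond_extend (Z V : T -> R) (phi : R * R -> R) :
  sigmaX Z -> sigmaX V -> L1 P V -> measurable_fun setT phi ->
  (forall A, measurable A -> \int[P]_(t in Z @^-1` A) (V t)%:E = 0)%E ->
  L1 P (fun t => phi (Z t, eps t) * V t) ->
  Ex P (fun t => phi (Z t, eps t) * V t) = 0.
Proof.
move=> sZ sV V1 mphi VZ h.
have mZ := sigmaX_meas _ sZ.
have mW : measurable_fun setT (fun t => (Z t, eps t)).
  exact: measurable_fun_pair.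
apply: (@Ex_orth _ _ _ _ _ P (fun t => (Z t, eps t)) V mW V1 _ phi mphi h).
pose G : set (set (R * R)) :=
  [set C | exists A, measurable A /\ exists B, measurable B /\ C = A `*` B].
apply: (integral0_pi_system _ _ _ mW V1 G).
- rewrite measurable_prod_measurableType //; congr (<<s _ >>).
  rewrite predeqE; split => [[A mA [B mB <-]]|[A [mA [B [mB ->]]]]].
    by exists A; split => //; exists B.
  by exists A => //; exists B.
- move=> /= _ _ [X1 [mX1 [X2 [mX2 ->]]]] [Y1 [mY1 [Y2 [mY2 ->]]]].
  rewrite -setXI; exists (X1 `&` Y1); split; first exact: measurableI.
  by exists (X2 `&` Y2); split => //; exact: measurableI.
- by rewrite -(VZ setT)// preimage_setT.
- move=> _ [A [mA [B [mB ->]]]].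
  have mZA : measurable (Z @^-1` A) by rewrite -[X in measurable X]setTI; exact: mZ.
  have mEB : measurable (eps @^-1` B) by rewrite -[X in measurable X]setTI; exact: meps.
  have -> : (fun t => (Z t, eps t)) @^-1` (A `*` B) = eps @^-1` B `&` Z @^-1` A.
    by rewrite setIC.
  rewrite Ex_mkcond//; last exact: measurableI.
  under [fun _ => _]eq_fun do rewrite indicI -mulrA.
  rewrite Ex_indep//.
  + by have := VZ _ mA; rewrite Ex_mkcond// => -[->]; rewrite mulr0.
  + apply: measurable_funM => //; apply: (@measurable_indic _ TX).
    by rewrite -[X in measurable X]setTI; exact: sZ.
  + apply: (@L1_bdM _ _ _ _ _ _ 1) => //.
    by move=> t; rewrite indicE ger0_norm// lern1 leq_b1.
Qed.

End Independence.

(** * The Euclidean inner product of column vectors *)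

Section DotProduct.
Context {R : realType} {p : nat}.
Implicit Types (u v : 'cV[R]_p) (A : 'M[R]_p).

Definition dotv u v : R := (u^T *m v) 0 0.

Lemma dotvE u v : dotv u v = \sum_i u i 0 * v i 0.
Proof. by rewrite /dotv mxE; apply: eq_bigr => i _; rewrite mxE. Qed.

Lemma dotvC u v : dotv u v = dotv v u.
Proof. by rewrite !dotvE; apply: eq_bigr => i _; rewrite mulrC. Qed.

Lemma dotvDr u v1 v2 : dotv u (v1 + v2) = dotv u v1 + dotv u v2.
Proof. by rewrite /dotv mulmxDr mxE. Qed.

Lemma dotvZr c u v : dotv u (c *: v) = c * dotv u v.
Proof. by rewrite /dotv -scalemxAr mxE. Qed.

Lemma dotvNr u v : dotv u (- v) = - dotv u v.
Proof. by rewrite -scaleN1r dotvZr mulN1r. Qed.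

Lemma dotvBr u v1 v2 : dotv u (v1 - v2) = dotv u v1 - dotv u v2.
Proof. by rewrite dotvDr dotvNr. Qed.

Lemma dotvDl u1 u2 v : dotv (u1 + u2) v = dotv u1 v + dotv u2 v.
Proof. by rewrite dotvC dotvDr !(dotvC v). Qed.

Lemma dotvZl c u v : dotv (c *: u) v = c * dotv u v.
Proof. by rewrite dotvC dotvZr (dotvC v). Qed.

Lemma dotvBl u1 u2 v : dotv (u1 - u2) v = dotv u1 v - dotv u2 v.
Proof. by rewrite dotvC dotvBr !(dotvC v). Qed.

Lemma dotv0l v : dotv 0 v = 0.
Proof. by rewrite -(scale0r 0) dotvZl mul0r. Qed.

Lemma dotv_sumr u (I : Type) (s : seq I) (F : I -> 'cV[R]_p) :
  dotv u (\sum_(i <- s) F i) = \sum_(i <- s) dotv u (F i).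
Proof.
elim: s => [|i s ih]; last by rewrite !big_cons dotvDr ih.
by rewrite !big_nil dotvC dotv0l.
Qed.

Lemma dotv_mulmx u A v : dotv u (A *m v) = dotv (A^T *m u) v.
Proof. by rewrite /dotv trmx_mul trmxK mulmxA. Qed.

Lemma dotv_eq0 u : (dotv u u == 0) = (u == 0).
Proof.
apply/idP/idP; last by move=> /eqP ->; rewrite dotv0l.
rewrite dotvE psumr_eq0; last by move=> i _; rewrite -expr2 sqr_ge0.
move=> /allP h; apply/eqP/matrixP => i j; rewrite ord1 mxE.
have := h i; rewrite mem_index_enum => /(_ isT).
by rewrite /= mulf_eq0 orbb => /eqP.
Qed.

Lemma dotv_delta i v : dotv (delta_mx i 0) v = v i 0.
Proof.
rewrite dotvE (bigD1 i)//= mxE !eqxx mul1r big1 ?addr0// => j ji.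
by rewrite mxE (negbTE ji) mul0r.
Qed.

End DotProduct.

(** * Vanishing conditional expectations *)

Section Conditional.
Context {R : realType} {d : measure_display} {T : measurableType d}.
Variable (P : probability T R).
Implicit Types Z U V : T -> R.

(** $E(V \mid Z) = 0$ in integrated form, so that no version of the conditional expectation has to
    be chosen. *)
Definition condexp0 Z V : Prop :=
  forall A, measurable A -> (\int[P]_(t in Z @^-1` A) (V t)%:E = 0)%E.

Lemma preimageT_meas Z A : measurable_fun setT Z -> measurable A ->
  measurable (Z @^-1` A).
Proof. by move=> mZ mA; rewrite -[X in measurable X]setTI; exact: mZ. Qed.

Lemma condexp0D Z U V : measurable_fun setT Z -> L1 P U -> L1 P V ->
  condexp0 Z U -> condexp0 Z V -> condexp0 Z (fun t => U t + V t).
Proof.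
move=> mZ U1 V1 U0 V0 A mA; have mZA := preimageT_meas _ _ mZ mA.
rewrite [LHS](_ : _ = \int[P]_(t in Z @^-1` A) ((U t)%:E + (V t)%:E))%E//.
rewrite integralD//; [|by apply: integrableS U1|by apply: integrableS V1].
by rewrite U0// V0// add0e.
Qed.

Lemma condexp0Z Z c U : measurable_fun setT Z -> L1 P U ->
  condexp0 Z U -> condexp0 Z (fun t => c * U t).
Proof.
move=> mZ U1 U0 A mA; have mZA := preimageT_meas _ _ mZ mA.
rewrite [LHS](_ : _ = \int[P]_(t in Z @^-1` A) (c%:E * (U t)%:E))%E//.
by rewrite integralZl//; [rewrite U0// mule0|apply: integrableS U1].
Qed.

Lemma condexp0_sum Z (I : Type) (s : seq I) (F : I -> T -> R) :
  measurable_fun setT Z -> (forall i, L1 P (F i)) ->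
  (forall i, condexp0 Z (F i)) -> condexp0 Z (fun t => \sum_(i <- s) F i t).
Proof.
move=> mZ F1 F0; elim: s => [|i s ih].
  under [fun _ => _]eq_fun do rewrite big_nil.
  by move=> A mA; rewrite integral0.
under [fun _ => _]eq_fun do rewrite big_cons.
by apply: condexp0D => //; exact: L1_sum.
Qed.

Lemma condexp_cond0 Z U g : measurable_fun setT Z -> is_condexp P Z U g ->
  [/\ measurable_fun setT g, L1 P U, L1 P (g \o Z) &
      condexp0 Z (fun t => U t - g (Z t))].
Proof.
move=> mZ [mg [U1 [g1 UE]]]; split => // A mA.
have mZA := preimageT_meas _ _ mZ mA.
rewrite [LHS](_ : _ = \int[P]_(t in Z @^-1` A) ((U t)%:E - (g (Z t))%:E))%E//.
rewrite integralB//; [|by apply: integrableS U1|by apply: integrableS g1].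
rewrite UE// subee//; apply: integrable_fin_num => //.
by apply: integrableS g1.
Qed.

(** Testing $g(Z)$ against its own sign, a bounded function of $Z$, gives $E|g(Z)| = 0$. *)
Lemma condexp0_comp_ae0 Z g : measurable_fun setT Z -> measurable_fun setT g ->
  L1 P (g \o Z) -> condexp0 Z (g \o Z) -> {ae P, forall t, g (Z t) = 0}.
Proof.
move=> mZ mg g1 g0.
(* The sign of [g], with value 1 where [g] vanishes. *)
pose s z : R := 2 * \1_(g @^-1` `[0, +oo[) z - 1.
have sg z : s z * g z = `|g z|.
  rewrite /s indicE; case: (boolP (z \in _)); rewrite ?inE ?notin_setE /= in_itv/= andbT.
    by move=> h; rewrite ger0_norm//; ring.
  by move=> /negP; rewrite -ltNge => h; rewrite ltr0_norm//; ring.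
have ms : measurable_fun setT s.
  apply: measurable_funB => //; apply: measurable_funM => //.
  apply: measurable_indic; rewrite -[X in measurable X]setTI.
  by apply: mg => //; exact: measurable_itv.
have N1 : L1 P (fun t => `|g (Z t)|) by exact: (integrable_norm g1).
have := @Ex_orth _ _ _ _ _ P Z (g \o Z) mZ g1 g0 s ms.
rewrite [fun t => s (Z t) * _](_ : _ = fun t => `|g (Z t)|); last first.
  by apply/funext => t; exact: sg.
move=> /(_ N1) E0.
have mgZ : measurable_fun setT (EFin \o (g \o Z)) by apply/measurable_EFinP/measurableT_comp.
have /(ae_eq_integral_abs P measurableT mgZ) : (\int[P]_(t in setT) `|(EFin \o (g \o Z)) t| = 0)%E.
  by have := congr1 EFin E0; rewrite Ex_EFin.
by apply: filterS => t /= /(_ I) [].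
Qed.

End Conditional.

(** * Consequences of the single-index model, the linearity condition and the constant variance
    condition *)

Section Model.
Context {R : realType} {d : measure_display} {T : measurableType d} {p : nat}.
Variables (P : probability T R) (Y : T -> R) (X : T -> 'cV[R]_p) (eps : T -> R).
Variables (f : R -> R -> R) (beta : 'cV[R]_p).
Hypotheses (mY : measurable_fun setT Y)
  (mX : forall i, measurable_fun setT (fun t => X t i 0))
  (meps : measurable_fun setT eps)
  (mf : measurable_fun setT (fun z : R * R => f z.1 z.2))
  (X2 : forall i, P.-integrable setT (fun t => (X t i 0 ^+ 2)%:E))
  (posdef : forall v : 'cV[R]_p, v != 0 -> 0 < (v^T *m law_cov P Y X *m v) 0 0)
  (beta0 : beta != 0)
  (Yf : forall t, Y t = f ((beta^T *m X t) 0 0) (eps t))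
  (indep : indep_vec P eps X)
  (lin : forall b : 'cV[R]_p, exists a0 a1 : R,
     is_condexp P (fun t => (beta^T *m X t) 0 0) (fun t => (b^T *m X t) 0 0)
       (fun z => a0 + a1 * z))
  (cvar : exists (m : R -> 'cV[R]_p) (V : 'M[R]_p),
     (forall i, is_condexp P (fun t => (beta^T *m X t) 0 0)
                  (fun t => X t i 0) (fun z => m z i 0)) /\
     (forall i j, is_condexp P (fun t => (beta^T *m X t) 0 0)
        (fun t => (X t i 0 - m ((beta^T *m X t) 0 0) i 0) *
                  (X t j 0 - m ((beta^T *m X t) 0 0) j 0))
        (fun _ => V i j))).

Let mu : 'cV[R]_p := law_mean P Y X.
Let Sig : 'M[R]_p := law_cov P Y X.
Let Z t := dotv beta (X t).
Definition centered (b : 'cV[R]_p) (t : T) : R := dotv b (X t - law_mean P Y X).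

Lemma L2_X i : L2 P (fun t => X t i 0).
Proof. by split; [exact: mX|exact: X2]. Qed.

Lemma muE i : mu i 0 = Ex P (fun t => X t i 0).
Proof. by rewrite /mu mxE. Qed.

Lemma xiE b t : centered b t = \sum_i b i 0 * (X t i 0 - mu i 0).
Proof. by rewrite /centered dotvE; apply: eq_bigr => i _; rewrite !mxE. Qed.

Lemma L2_xi b : L2 P (centered b).
Proof.
rewrite (funext (xiE b)).
apply: L2_sum => i; apply: L2Z; apply: L2B; [exact: L2_X|exact: L2_cst].
Qed.

Lemma sigmaX_xi b : sigmaX X (centered b).
Proof.
rewrite /sigmaX; rewrite (funext (xiE b)).
apply: measurable_sum => i; apply: measurable_funM => //.
by apply: measurable_funB => //; exact: sigmaX_coord.
Qed.

Lemma ZE t : Z t = centered beta t + dotv beta mu.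
Proof. by rewrite /centered -/mu dotvBr subrK. Qed.

Lemma L2_Z : L2 P Z.
Proof.
rewrite (funext ZE).
by apply: L2D; [exact: L2_xi|exact: L2_cst].
Qed.

Let mZ : measurable_fun setT Z. Proof. exact: L2_Z.1. Qed.

Lemma sigmaX_Z : sigmaX X Z.
Proof.
rewrite /sigmaX; rewrite (funext ZE).
by apply: measurable_funD => //; exact: sigmaX_xi.
Qed.

Lemma Ex_xi b : Ex P (centered b) = 0.
Proof.
have L i : L2 P (fun t => X t i 0 - mu i 0) by apply: L2B; [exact: L2_X|exact: L2_cst].
rewrite (funext (xiE b)).
rewrite Ex_sum; last by move=> i; apply: L1Z; exact: L2_L1.
rewrite big1// => i _; rewrite ExZ; last exact: L2_L1.
rewrite ExB; [|exact/L2_L1/L2_X|exact: L1_cst].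
by rewrite Ex_cst muE subrr mulr0.
Qed.

Lemma Ex_xixi b c : Ex P (fun t => centered b t * centered c t) = dotv b (Sig *m c).
Proof.
have L i : L2 P (fun t => X t i 0 - mu i 0) by apply: L2B; [exact: L2_X|exact: L2_cst].
have LL i j : L1 P (fun t => (X t i 0 - mu i 0) * (X t j 0 - mu j 0)) by exact: L2_mulL1.
transitivity (Ex P (fun t => \sum_i \sum_j
    (b i 0 * c j 0) * ((X t i 0 - mu i 0) * (X t j 0 - mu j 0)))).
  congr (Ex P _); apply/funext => t; rewrite !xiE mulr_suml; apply: eq_bigr => i _.
  by rewrite mulr_sumr; apply: eq_bigr => j _; ring.
rewrite Ex_sum; last by move=> i; apply: L1_sum => j; exact: L1Z.
rewrite dotvE; apply: eq_bigr => i _.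
rewrite Ex_sum; last by move=> j; exact: L1Z.
rewrite [(Sig *m c) i 0]mxE mulr_sumr; apply: eq_bigr => j _.
have -> : Sig i j = Ex P (fun t => (X t i 0 - mu i 0) * (X t j 0 - mu j 0)).
  by rewrite /Sig mxE.
by rewrite ExZ//; ring.
Qed.

Lemma Sig_sym : Sig^T = Sig.
Proof.
apply/matrixP => i j; rewrite !mxE /law_exp; apply: eq_Rintegral => t _.
by rewrite mulrC.
Qed.

Lemma Sig_dotC b c : dotv b (Sig *m c) = dotv c (Sig *m b).
Proof. by rewrite dotv_mulmx Sig_sym dotvC. Qed.

Lemma Sig_pos b : b != 0 -> 0 < dotv b (Sig *m b).
Proof. by move=> /posdef; rewrite /dotv mulmxA. Qed.

(** A nonzero row of the left kernel would be a direction of zero variance, against positive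
    definiteness. *)
Lemma Sig_unit : Sig \in unitmx.
Proof.
rewrite -row_free_unit -kermx_eq0; apply/eqP/row_matrixP => i; rewrite row0.
apply/eqP; rewrite -trmx_eq0; apply/negPn/negP => /Sig_pos.
rewrite /dotv trmxK mulmxA.
have -> : row i (kermx Sig) *m Sig = 0 by rewrite -row_mul mulmx_ker row0.
by rewrite mul0mx mxE ltxx.
Qed.

(** The linearity condition gives $E(b^T X \mid Z) = a_0 + a_1 Z$. Taking expectations removes the
    constant after centring, and $b^T \Sigma \beta = 0$ forces $a_1 = 0$. *)
Lemma condexp0_xi b : dotv b (Sig *m beta) = 0 -> condexp0 P Z (centered b).
Proof.
move=> bb; have [a0 [a1 /(condexp_cond0 _ _ _ _ mZ)[mg b1 g1 U0]]] := lin b.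
pose U t := dotv b (X t) - (a0 + a1 * Z t).
have U1 : L1 P U by exact: L1B.
have E0 : Ex P U = 0.
  have := @Ex_orth _ _ _ _ _ P Z U mZ U1 U0 (fun=> 1) (measurable_cst _).
  by under [fun _ => 1 * _]eq_fun do rewrite mul1r; exact.
have UE t : U t = (centered b t - a1 * centered beta t) + (dotv b mu - (a0 + a1 * dotv beta mu)).
  by rewrite /U ZE /centered -/mu !dotvBr; ring.
have Lb := L2_xi b; have LB := L2_xi beta.
have L : L2 P (fun t => centered b t - a1 * centered beta t) by apply: L2B => //; exact: L2Z.
have c0 : dotv b mu - (a0 + a1 * dotv beta mu) = 0.
  move: E0; rewrite (funext UE).
  rewrite ExD; [|exact: L2_L1|exact: L1_cst].
  by rewrite ExB ?ExZ ?Ex_xi ?Ex_cst; [lra|try (exact: L2_L1); try (apply: L1Z; exact: L2_L1)..].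
have UE' t : U t = centered b t - a1 * centered beta t by rewrite UE c0 addr0.
(* Testing [U] against $Z - E Z$ gives $b^T \Sigma \beta - a_1 \beta^T \Sigma \beta = 0$, where
   $\beta^T \Sigma \beta > 0$. *)
have a10 : a1 = 0.
  have := @Ex_orth _ _ _ _ _ P Z U mZ U1 U0 (fun z => z - dotv beta mu).
  have -> : (fun t => (Z t - dotv beta mu) * U t) =
      fun t => centered b t * centered beta t - a1 * (centered beta t * centered beta t).
    by apply/funext => t; rewrite UE' ZE; ring.
  have h1 : L1 P (fun t => centered b t * centered beta t) by exact: L2_mulL1.
  have h2 : L1 P (fun t => centered beta t * centered beta t) by exact: L2_mulL1.
  rewrite ExB ?ExZ ?Ex_xixi//; last exact: L1Z.
  rewrite bb sub0r => /(_ _ _)/eqP; rewrite oppr_eq0 mulf_eq0.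
  have := Sig_pos _ beta0; rewrite lt0r => /andP[/negbTE -> _].
  rewrite orbF => /(_ _ _)/eqP; apply.
  - exact: measurable_funB.
  - by apply: L1B => //; exact: L1Z.
by have -> : centered b = U by apply/funext => t; rewrite UE' a10 mul0r subr0.
Qed.

(** As $Y = f(Z, \varepsilon)$, any function of $(Y, Z)$ is a function of $(Z, \varepsilon)$, and
    conditioning on the latter pair is available by independence. *)
Lemma Ex_g_xi (g : R * R -> R) b : dotv b (Sig *m beta) = 0 ->
  measurable_fun setT g ->
  L1 P (fun t => g (Y t, Z t) * centered b t) -> Ex P (fun t => g (Y t, Z t) * centered b t) = 0.
Proof.
move=> bb mg L.
have mphi : measurable_fun setT (fun z : R * R => g (f z.1 z.2, z.1)).
  by apply: measurableT_comp => //; apply: measurable_fun_pair.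
have := Ex_cond_extend P X eps mX meps indep Z (centered b) _ sigmaX_Z (sigmaX_xi b)
  (L2_L1 _ _ (L2_xi b)) mphi (condexp0_xi _ bb).
by under [fun t => _ * _]eq_fun do rewrite /= -[f _ _]Yf; exact.
Qed.

(** Both $b^T m(Z)$ and the constant $b^T \mu$ are conditional means of $b^T X$ given $Z$, hence
    agree almost surely. So $(b^T(X - \mu))^2$ has conditional mean $b^T V b$ (the constant [Q]),
    and a full expectation identifies it as $b^T \Sigma b$. *)
Lemma condexp0_xi2 b : dotv b (Sig *m beta) = 0 ->
  condexp0 P Z (fun t => centered b t ^+ 2 - dotv b (Sig *m b)).
Proof.
move=> bb; have [m [V [mE VE]]] := cvar.
pose D t i := X t i 0 - m (Z t) i 0.
have mc i := condexp_cond0 _ _ _ _ mZ (mE i).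
have Vc i j := condexp_cond0 _ _ _ _ mZ (VE i j).
have D1 i : L1 P (D^~ i) by case: (mc i) => *; exact: L1B.
have DD1 i j : L1 P (fun t => D t i * D t j) by case: (Vc i j).
pose g z := dotv b (m z) - dotv b mu.
have xiD t : \sum_i b i 0 * D t i = centered b t - g (Z t).
  rewrite /g /centered -/mu dotvBr !dotvE; under eq_bigr do rewrite /D mulrBr.
  by rewrite sumrB; ring.
have SD1 : L1 P (fun t => \sum_i b i 0 * D t i) by apply: L1_sum => i; exact: L1Z.
have mg : measurable_fun setT g.
  rewrite /g; under [fun _ => _]eq_fun do rewrite dotvE.
  apply: measurable_funB => //; apply: measurable_sum => i; apply: measurable_funM => //.
  by case: (mc i).
have xi1 := L2_L1 _ _ (L2_xi b).
have gE : (g \o Z) = (fun t => centered b t + (-1) * \sum_i b i 0 * D t i).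
  by apply/funext => t /=; rewrite xiD; ring.
have g1 : L1 P (g \o Z) by rewrite gE; apply: L1D => //; exact: L1Z.
have g0 : condexp0 P Z (g \o Z).
  rewrite gE; apply: condexp0D => //; [exact: L1Z|exact: condexp0_xi|].
  apply: condexp0Z => //; apply: condexp0_sum => // i; first exact: L1Z.
  by apply: condexp0Z => //; case: (mc i).
have gae := condexp0_comp_ae0 _ _ _ mZ mg g1 g0.
pose Q := \sum_i \sum_j b i 0 * b j 0 * V i j.
have L2x : L1 P (fun t => centered b t ^+ 2) by case: (L2_xi b).
have sq : {ae P, forall t, (\sum_i \sum_j (b i 0 * b j 0) * (D t i * D t j - V i j)) =
    centered b t ^+ 2 - Q}.
  apply: filterS gae => t gt.
  have -> : centered b t = \sum_i b i 0 * D t i by rewrite xiD gt subr0.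
  rewrite expr2 mulr_suml /Q -sumrB; apply: eq_bigr => i _.
  by rewrite mulr_sumr -sumrB; apply: eq_bigr => j _; ring.
have LD : L1 P (fun t => \sum_i \sum_j (b i 0 * b j 0) * (D t i * D t j - V i j)).
  apply: L1_sum => i; apply: L1_sum => j; apply: L1Z; apply: L1B => //.
  exact: L1_cst.
have LQ : L1 P (fun t => centered b t ^+ 2 - Q) by apply: L1B => //; exact: L1_cst.
have c0 : condexp0 P Z (fun t => centered b t ^+ 2 - Q).
  move=> A mA; have mZA := preimageT_meas _ _ mZ mA.
  transitivity (\int[P]_(t in Z @^-1` A)
     (\sum_i \sum_j (b i 0 * b j 0) * (D t i * D t j - V i j))%:E)%E.
    apply: ae_eq_integral => //.
    - by apply: measurable_funTS; exact: measurable_int LQ.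
    - by apply: measurable_funTS; exact: measurable_int LD.
    - by apply: filterS sq => t /= -> _.
  have LV i j : L1 P (fun t => D t i * D t j - V i j).
    by apply: L1B => //; exact: L1_cst.
  have C : condexp0 P Z (fun t => \sum_i \sum_j (b i 0 * b j 0) * (D t i * D t j - V i j)).
    apply: condexp0_sum => // i; first by apply: L1_sum => j; exact: L1Z.
    apply: condexp0_sum => // j; first exact: L1Z.
    by apply: condexp0Z => //; case: (Vc i j).
  exact: C.
have QE : Q = dotv b (Sig *m b).
  have := c0 _ measurableT; rewrite preimage_setT -Ex_EFin// => -[].
  rewrite ExB//; last exact: L1_cst.
  by under [fun t => _ ^+ 2]eq_fun do rewrite expr2; rewrite Ex_xixi Ex_cst; lra.
by rewrite -QE.
Qed.

Lemma Ex_g_xi2 (g : R * R -> R) b : dotv b (Sig *m beta) = 0 ->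
  measurable_fun setT g -> L1 P (fun t => g (Y t, Z t)) ->
  L1 P (fun t => g (Y t, Z t) * centered b t ^+ 2) ->
  Ex P (fun t => g (Y t, Z t) * centered b t ^+ 2) =
  dotv b (Sig *m b) * Ex P (fun t => g (Y t, Z t)).
Proof.
move=> bb mg L Lx.
have mphi : measurable_fun setT (fun z : R * R => g (f z.1 z.2, z.1)).
  by apply: measurableT_comp => //; apply: measurable_fun_pair.
pose c := dotv b (Sig *m b).
have sx : sigmaX X (fun t => centered b t ^+ 2 - c).
  by apply: measurable_funB => //; apply: measurable_funX; exact: sigmaX_xi.
have L' : L1 P (fun t => centered b t ^+ 2 - c).
  by apply: L1B; [case: (L2_xi b)|exact: L1_cst].
have := Ex_cond_extend P X eps mX meps indep Z (fun t => centered b t ^+ 2 - c) _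
  sigmaX_Z sx L' mphi (condexp0_xi2 _ bb).
under [fun t => _ * _]eq_fun do rewrite /= -[f _ _]Yf mulrBr [_ * c]mulrC.
rewrite ExB ?ExZ//; last exact: L1Z.
by move=> /(_ (L1B _ _ _ Lx (L1Z _ _ _ L)))/eqP; rewrite subr_eq0 => /eqP.
Qed.

Lemma xiD b c t : centered (b + c) t = centered b t + centered c t.
Proof. exact: dotvDl. Qed.

Lemma xiZ a b t : centered (a *: b) t = a * centered b t.
Proof. exact: dotvZl. Qed.

(** Polarization: the quadratic identity is applied to [b], [c] and [b + c]. *)
Lemma Ex_g_xixi (g : R * R -> R) b c : dotv b (Sig *m beta) = 0 ->
  dotv c (Sig *m beta) = 0 -> measurable_fun setT g -> L1 P (fun t => g (Y t, Z t)) ->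
  L1 P (fun t => g (Y t, Z t) * centered b t ^+ 2) ->
  L1 P (fun t => g (Y t, Z t) * centered c t ^+ 2) ->
  L1 P (fun t => g (Y t, Z t) * (centered b t * centered c t)) ->
  Ex P (fun t => g (Y t, Z t) * (centered b t * centered c t)) =
  dotv b (Sig *m c) * Ex P (fun t => g (Y t, Z t)).
Proof.
move=> bb cc mg L Lb Lc Lbc.
have bc : dotv (b + c) (Sig *m beta) = 0 by rewrite dotvDl bb cc addr0.
have E : (fun t => g (Y t, Z t) * centered (b + c) t ^+ 2) =
  (fun t => g (Y t, Z t) * centered b t ^+ 2 + g (Y t, Z t) * centered c t ^+ 2
    + 2 * (g (Y t, Z t) * (centered b t * centered c t))).
  by apply/funext => t; rewrite xiD; ring.
have Lbc' : L1 P (fun t => g (Y t, Z t) * centered (b + c) t ^+ 2).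
  by rewrite E; apply: L1D; [exact: L1D|exact: L1Z].
have := Ex_g_xi2 g _ bc mg L Lbc'.
rewrite E ExD ?ExD ?ExZ//; [|exact: L1D|exact: L1Z].
rewrite !Ex_g_xi2// mulmxDr !dotvDr !dotvDl (Sig_dotC c b).
set e := Ex P _; set e' := Ex P _; lra.
Qed.

(** Here [c] is arbitrary. Its part along [beta] contributes a function of $(Y, Z)$ times
    [centered b], which has mean 0; the remaining part [c'] is $\Sigma$-orthogonal to [beta], and
    polarization applies. *)
Lemma Ex_bd_xixi (g : R * R -> R) b c k : dotv b (Sig *m beta) = 0 ->
  measurable_fun setT g -> (forall z, `|g z| <= k) ->
  Ex P (fun t => g (Y t, Z t) * (centered b t * centered c t)) =
  dotv b (Sig *m c) * Ex P (fun t => g (Y t, Z t)).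
Proof.
move=> bb mg gk.
have s0 := Sig_pos _ beta0; pose s := dotv c (Sig *m beta) / dotv beta (Sig *m beta).
pose c' := c - s *: beta.
have cc : dotv c' (Sig *m beta) = 0.
  by rewrite dotvBl dotvZl /s divfK ?subrr// gt_eqF.
have mgYZ : measurable_fun setT (fun t => g (Y t, Z t)).
  apply: measurableT_comp => //; apply: measurable_fun_pair => //.
have Lg h : L1 P h -> L1 P (fun t => g (Y t, Z t) * h t).
  by apply: (L1_bdM _ _ _ k) => // t; exact: gk.
have L2b := L2_xi b; have L2c := L2_xi c'; have L2B := L2_xi beta.
pose g' z := g z * (z.2 - dotv beta mu).
have mg' : measurable_fun setT g'.
  by apply: measurable_funM => //; exact: measurable_funB.
have E : (fun t => g (Y t, Z t) * (centered b t * centered c t)) =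
    (fun t => g (Y t, Z t) * (centered b t * centered c' t) + s * (g' (Y t, Z t) * centered b t)).
  apply/funext => t; rewrite /g' /= [in X in _ * (X - _)]ZE.
  have -> : centered c t = centered c' t + s * centered beta t by rewrite -xiZ -xiD /c' subrK.
  ring.
have L1g1 : L1 P (fun t => g (Y t, Z t)).
  have := Lg _ (L1_cst _ 1); by under [fun t => _ * 1]eq_fun do rewrite mulr1.
have L1g' : L1 P (fun t => g' (Y t, Z t) * centered b t).
  have := Lg _ (L2_mulL1 _ _ _ L2B L2b); congr (L1 P _); apply/funext => t.
  by rewrite /g' /= ZE; ring.
have L1b := Lg _ (L2_mulL1 _ _ _ L2b L2c).
rewrite E ExD ?ExZ//; last exact: L1Z.
rewrite (Ex_g_xi g')// mulr0 addr0 Ex_g_xixi//; [|exact/Lg/L2b.2|exact/Lg/L2c.2].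
by rewrite /c' mulmxBr dotvBr -scalemxAr dotvZr bb mulr0 subr0.
Qed.

End Model.

(** * Slice indicators and half-lines *)

Section SliceIndicator.
Context {R : realType}.
Implicit Types (q : nat -> R) (y : R).

Definition below (a y : R) : R := (y <= a)%R%:R.

Definition slice_upper (H : nat) q (h : nat) y : R :=
  if h.+1 == H then 1 else below (q h) y.

Definition slice_lower q (h : nat) y : R :=
  if h == 0%N then 0 else below (q h.-1) y.

(** For increasing boundaries a slice is a difference of two nested half-lines, so slice moments
    reduce to integrals over half-lines. *)
Lemma slice_indE H q (h : 'I_H) y :
  (forall i : nat, (i.+2 < H)%N -> q i < q i.+1) ->
  slice_ind H q h y = slice_upper H q h y - slice_lower q h y.
Proof.
move=> qlt; rewrite /slice_ind /in_slice /slice_upper /slice_lower /below.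
case: h => -[|k] hk /=.
  by rewrite subr0; case: eqP.
have [kH|kH] := eqVneq k.+2 H; rewrite ?andbT /=.
  by rewrite ltNge; case: (y <= q k)%R; rewrite /= ?subrr ?subr0.
have /qlt qk : (k.+2 < H)%N by rewrite ltn_neqAle kH.
rewrite ltNge; have [yk|yk] /= := leP y (q k); last by rewrite subr0.
by rewrite (le_trans yk (ltW qk)) subrr.
Qed.

(** Membership only depends on the comparisons of [y] with the genuine boundaries, those with
    [i.+1 < H]; further values of the sequence carry no meaning. *)
Lemma eq_in_slice H q q' (h : 'I_H) y :
  (forall i : nat, (i.+1 < H)%N -> (y <= q' i) = (y <= q i)) ->
  slice_ind H q' h y = slice_ind H q h y.
Proof.
move=> qq; rewrite /slice_ind /in_slice; congr (_ %:R).
case: h => -[|k] hk /=.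
  by case: eqP => //= /eqP H1; rewrite qq// ltn_neqAle H1.
rewrite !ltNge (qq _ hk); case: (eqVneq k.+2 H) => //= H1.
by rewrite qq// ltn_neqAle H1.
Qed.

Lemma slice_ind01 H q (h : 'I_H) y : 0 <= slice_ind H q h y <= 1.
Proof. by rewrite /slice_ind; case: in_slice; rewrite /= ?lexx ?ler01. Qed.

Lemma slice_ind_norm H q (h : 'I_H) y : `|slice_ind H q h y| <= 1.
Proof. by have /andP[h0 h1] := slice_ind01 H q h y; rewrite ger0_norm. Qed.

Lemma slice_ind_sqr H q (h : 'I_H) y : slice_ind H q h y ^+ 2 = slice_ind H q h y.
Proof. by rewrite /slice_ind; case: in_slice; rewrite /= ?expr1n ?expr0n. Qed.

(** For [h < k], a point of slice [k] exceeds [q k.-1], which is at least [q h], the upper end of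
    slice [h]. *)
Lemma slice_ind_disj H q (h k : 'I_H) y :
  (forall i : nat, (i.+2 < H)%N -> q i < q i.+1) -> h != k ->
  slice_ind H q h y * slice_ind H q k y = 0.
Proof.
move=> qlt; wlog hk : h k / (h < k)%N.
  move=> W hk; have : nat_of_ord h != k by [].
  rewrite neq_ltn => /orP[lt|lt]; first exact: W.
  by rewrite mulrC W// eq_sym.
move=> _; rewrite /slice_ind /in_slice.
have k0 : (nat_of_ord k == 0%N) = false by case: (nat_of_ord k) hk.
have hH : ((nat_of_ord h).+1 == H) = false.
  by apply/negbTE; rewrite neq_ltn (leq_ltn_trans hk (ltn_ord k)).
have qhk : q h <= q k.-1.
  have : (h <= k.-1)%N by case: (nat_of_ord k) hk.
  have : (k.-1.+1 < H)%N.
    by rewrite prednK ?ltn_ord// lt0n k0.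
  elim: (nat_of_ord k).-1 => [|n ih] nH.
    by rewrite leqn0 => /eqP ->.
  rewrite leq_eqVlt => /orP[/eqP <-//|hn].
  by apply: (le_trans (ih (ltnW nH) hn)); apply/ltW/qlt.
rewrite k0 hH /=; case: (ltP (q k.-1) y) => [l1|]; last by rewrite /= mulr0.
by rewrite leNgt (le_lt_trans qhk l1) andbF mul0r.
Qed.

Lemma measurable_slice_ind H q (h : 'I_H) :
  measurable_fun setT (slice_ind H q h).
Proof.
have mb a : measurable_fun setT (fun y : R => (y <= a : bool)).
  by apply: measurable_fun_ler.
have mb' a : measurable_fun setT (fun y : R => (a < y : bool)).
  by apply: measurable_fun_ltr.
apply: (measurableT_comp (f := fun b : bool => b%:R : R)) => //.
rewrite /in_slice; apply: measurable_and; apply: measurable_or => //.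
Qed.

Lemma measurable_below a : measurable_fun setT (below a).
Proof.
apply: (measurableT_comp (f := fun b : bool => b%:R : R)) => //.
exact: measurable_fun_ler.
Qed.

Lemma below_norm a y : `|below a y| <= 1.
Proof. by rewrite /below; case: (y <= a)%R; rewrite ?normr1 ?normr0 ?ler01. Qed.

End SliceIndicator.

(** * Slice moments under the law of $(Y, X)$ and its point contaminations *)

Section LinearOperators.
Context {R : realType} {d : measure_display} {T : measurableType d} {p : nat}.
Variables (P : probability T R) (Y : T -> R) (X : T -> 'cV[R]_p).
Hypotheses (mY : measurable_fun setT Y).
Implicit Types (phi psi : R -> 'cV[R]_p -> R) (E : expop R p).

Definition LG phi : Prop := L1 P (fun t => phi (Y t) (X t)).

(** The rules shared by the law and its contaminations, so that the slice algebra is carried out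
    once for both. *)
Definition linop E : Prop :=
  (forall phi psi, LG phi -> LG psi ->
     E (fun y x => phi y x + psi y x) = E phi + E psi) /\
  (forall c phi, LG phi -> E (fun y x => c * phi y x) = c * E phi).

Lemma linop_law : linop (law_exp P Y X).
Proof. by split => [phi psi|c phi] *; [exact: ExD|exact: ExZ]. Qed.

Lemma linop_mix e y0 x0 : linop (mixexp (law_exp P Y X) e y0 x0).
Proof.
have [D Z] := linop_law.
split => [phi psi|c phi] *; rewrite /mixexp; first by rewrite D//; ring.
by rewrite Z//; ring.
Qed.

Lemma linop_sum E (I : Type) (s : seq I) (F : I -> R -> 'cV[R]_p -> R) :
  linop E -> (forall i, LG (F i)) ->
  E (fun y x => \sum_(i <- s) F i y x) = \sum_(i <- s) E (F i).
Proof.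
move=> [D Z] LF; elim: s => [|i s ih].
  (* Homogeneity with scalar 0 gives the value 0 at the zero function. *)
  rewrite [RHS]big_nil; have := Z 0 _ (L1_cst P 0 : LG (fun _ _ => 0)).
  rewrite [RHS]mul0r => E0; apply: etrans E0.
  by congr E; apply/funext => y; apply/funext => x; rewrite big_nil mul0r.
rewrite big_cons -ih -D//; last exact: (L1_sum P _ s (fun i t => F i (Y t) (X t))).
by congr E; apply/funext => y; apply/funext => x; rewrite big_cons.
Qed.

Lemma linopB E phi psi : linop E -> LG phi -> LG psi ->
  E (fun y x => phi y x - psi y x) = E phi - E psi.
Proof.
move=> [D Z] Lp Ls.
have -> : (fun y x => phi y x - psi y x) = (fun y x => phi y x + (-1) * psi y x).
  by apply/funext => y; apply/funext => x; rewrite mulN1r.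
by rewrite D ?Z ?mulN1r//; exact: L1Z.
Qed.

Lemma LG_bd (u : R -> R) c phi : measurable_fun setT u -> (forall y, `|u y| <= c) ->
  LG phi -> LG (fun y x => u y * phi y x).
Proof.
move=> mu uc L; apply: (@L1_bdM _ _ _ P (fun t => u (Y t)) _ c) => //.
exact: measurableT_comp.
Qed.

Lemma LG_slice H q (h : 'I_H) phi : LG phi -> LG (fun y x => slice_ind H q h y * phi y x).
Proof.
by apply: (@LG_bd _ 1); [exact: measurable_slice_ind|exact: slice_ind_norm].
Qed.

Lemma LG_below a phi : LG phi -> LG (fun y x => below a y * phi y x).
Proof. by apply: (@LG_bd _ 1); [exact: measurable_below|exact: below_norm]. Qed.

Lemma LG_cst c : LG (fun _ _ => c).
Proof. exact: L1_cst. Qed.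

Lemma LG_below1 a : LG (fun y _ => below a y).
Proof.
have := LG_below a _ (LG_cst 1); congr LG.
by apply/funext => y; apply/funext => x; rewrite mulr1.
Qed.

Lemma LG_slice1 H q (h : 'I_H) : LG (fun y _ => slice_ind H q h y).
Proof.
have := LG_slice H q h _ (LG_cst 1); congr LG.
by apply/funext => y; apply/funext => x; rewrite mulr1.
Qed.

Lemma slice_opE E H q (h : 'I_H) phi : linop E -> LG phi ->
  (forall i : nat, (i.+2 < H)%N -> q i < q i.+1) ->
  E (fun y x => slice_ind H q h y * phi y x) =
  (if h.+1 == H then E phi else E (fun y x => below (q h) y * phi y x)) -
  (if h == 0%N :> nat then 0 else E (fun y x => below (q h.-1) y * phi y x)).
Proof.
move=> LE L qlt; have [_ Z] := LE.
have -> : (fun y x => slice_ind H q h y * phi y x) =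
    (fun y x => slice_upper H q h y * phi y x - slice_lower q h y * phi y x).
  by apply/funext => y; apply/funext => x; rewrite slice_indE// mulrBl.
rewrite linopB//; last 2 first.
- rewrite /slice_upper; case: eqP => _; last exact: LG_below.
  exact: (L1Z P 1).
- rewrite /slice_lower; case: eqP => _; last exact: LG_below.
  exact: (L1Z P 0).
congr (_ - _).
- rewrite /slice_upper; case: eqP => // _.
  by rewrite Z// mul1r.
- rewrite /slice_lower; case: eqP => // _.
  by rewrite Z// mul0r.
Qed.

Lemma below_rec E H q w i : linop E -> valid_slicing E H q w ->
  forall iH : (i.+2 < H)%N,
  E (fun y _ => below (q i.+1) y) = E (fun y _ => below (q i) y) + w (Ordinal (ltnW iH)).
Proof.
move=> LE [qlt wE] iH; rewrite -wE /sl_w.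
have := slice_opE E H q (Ordinal (ltnW iH)) _ LE (LG_cst 1) qlt.
rewrite /= (ltn_eqF iH).
have S (u : R -> R) : (fun y (_ : 'cV[R]_p) => u y * 1) = (fun y _ => u y).
  by apply/funext => y; apply/funext => x; rewrite mulr1.
by rewrite !S => ->; ring.
Qed.

(** Both sides equal $w_0 + \dots + w_i$, because the slicing proportions are prescribed. *)
Lemma below_eq E E' H q q' w i : linop E -> linop E' ->
  valid_slicing E H q w -> valid_slicing E' H q' w -> (i.+1 < H)%N ->
  E (fun y _ => below (q i) y) = E' (fun y _ => below (q' i) y).
Proof.
move=> LE LE' V V'; elim: i => [|i ih] iH; last first.
  by rewrite (below_rec _ _ _ _ _ LE V iH) (below_rec _ _ _ _ _ LE' V' iH) ih// ltnW.
have K (F : expop R p) r : valid_slicing F H r w ->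
    F (fun y _ => below (r 0%N) y) = w (Ordinal (ltnW iH)).
  move=> [_ <-]; rewrite /sl_w; congr F; apply/funext => y; apply/funext => x.
  by rewrite /slice_ind /in_slice /= (ltn_eqF iH).
by rewrite (K _ _ V) (K _ _ V').
Qed.

Let G := law_exp P Y X.
Definition cdf a := law_exp P Y X (fun y _ => below a y).

Lemma cdf_le a b : a <= b -> cdf a <= cdf b.
Proof.
move=> ab; apply: le_Ex; [exact: (LG_below1 a)|exact: (LG_below1 b)|move=> t].
by rewrite /below ler_nat; case: (leP (Y t) a) => // ya; rewrite (le_trans ya ab).
Qed.

(** * Displacement of the slice boundaries under contamination *)

Section Perturbation.
Variables (H : nat) (w : 'I_H -> R) (q q' : nat -> R) (e y0 : R) (x0 : 'cV[R]_p).
Hypotheses (w0 : forall h, 0 < w h) (V : valid_slicing G H q w)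
  (V' : valid_slicing (mixexp G e y0 x0) H q' w) (e01 : 0 < e < 1).

Lemma cdf_mix i : (i.+1 < H)%N -> cdf (q i) = (1 - e) * cdf (q' i) + e * below (q' i) y0.
Proof.
move=> iH; apply: (below_eq _ _ _ _ _ _ _ _ _ V V' iH).
- exact: linop_law.
- exact: linop_mix.
Qed.

(** Slice [i] lies at or below [q i] and slice [i.+1] above it. Their positive masses give this
    bound and the next one. *)
Lemma cdf_gt0 i : (i.+1 < H)%N -> 0 < cdf (q i).
Proof.
move=> iH; apply: (lt_le_trans (w0 (Ordinal (ltnW iH)))).
have [_ <-] := V; apply: le_Ex; [exact: LG_slice1|exact: (LG_below1 (q i))|move=> t].
rewrite /slice_ind /in_slice /= (ltn_eqF iH) /= ler_nat.
by case: (Y t <= q i); rewrite ?andbF// leq_b1.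
Qed.

Lemma cdf_lt1 i : (i.+1 < H)%N -> cdf (q i) < 1.
Proof.
move=> iH; rewrite -subr_gt0; apply: (lt_le_trans (w0 (Ordinal iH))).
have [_ <-] := V; rewrite -(Ex_cst P 1) -ExB; [|exact: L1_cst|exact: LG_below1].
apply: le_Ex; [exact: LG_slice1|apply: L1B; [exact: L1_cst|exact: (LG_below1 (q i))]|].
move=> t; rewrite /slice_ind /in_slice /= /below ltNge.
by case: (Y t <= q i) => /=; rewrite ?subrr ?subr0//; case: (_ || _).
Qed.

(* As 0 < cdf (q i) < 1, a boundary crossing y0 would contradict monotonicity of cdf. *)
Lemma below_stable i : (i.+1 < H)%N -> (y0 <= q' i) = (y0 <= q i).
Proof.
move=> iH; have E := cdf_mix _ iH; have c0 := cdf_gt0 _ iH; have c1 := cdf_lt1 _ iH.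
move: E; rewrite /below; have [yq'|yq'] := leP y0 (q' i); have [yq|yq] := leP y0 (q i) => //=.
- have := cdf_le _ _ (le_trans (ltW yq) yq'); move: e01 => /andP[e0 e1] L; nra.
- have := cdf_le _ _ (le_trans (ltW yq') yq); move: e01 => /andP[e0 e1] L; nra.
Qed.

Lemma slice_ind_stable (h : 'I_H) : slice_ind H q' h y0 = slice_ind H q h y0.
Proof. by apply: eq_in_slice => i; exact: below_stable. Qed.

(** By the mixture equation the signed difference times $1 - e$ is [e] times the difference of two
    numbers in $[0, 1]$. *)
Lemma cdf_dist i : (i.+1 < H)%N -> (1 - e) * `|cdf (q' i) - cdf (q i)| <= e.
Proof.
move=> iH; have E := cdf_mix _ iH; have c0 := cdf_gt0 _ iH; have c1 := cdf_lt1 _ iH.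
have /andP[e0 e1] := e01; have e1' : 0 <= 1 - e by rewrite subr_ge0 ltW.
rewrite -[X in X * _](ger0_norm e1') -normrM.
have -> : (1 - e) * (cdf (q' i) - cdf (q i)) = e * (cdf (q i) - below (q' i) y0).
  by rewrite E; ring.
rewrite normrM (gtr0_norm e0) ler_piMr ?(ltW e0)// ler_norml /below.
by case: (y0 <= q' i) => /=; apply/andP; split; lra.
Qed.
End Perturbation.

(** Two half-lines differ by an event $a < Y \le b$ whose probability is the difference of the [cdf]
    values; absolute continuity of the integral concludes. Closeness is measured in probability, so
    [Y] may have atoms or gaps. *)
Lemma below_abscont phi eta : LG phi -> 0 < eta -> exists2 dl, 0 < dl &
  forall a b, `|cdf a - cdf b| < dl ->
   `|G (fun y x => below a y * phi y x) - G (fun y x => below b y * phi y x)| <= eta.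
Proof.
move=> L eta0; have [dl [dl0 dlP]] := integral_normr_continuous L eta0.
exists dl => // a b.
wlog ab : a b / a <= b.
  move=> W; case: (leP a b) => [|/ltW] ab; first exact: W.
  by rewrite distrC => /(W _ _ ab); rewrite distrC.
have La := LG_below a _ L; have Lb := LG_below b _ L.
move=> cl; rewrite distrC -linopB//; last exact: linop_law.
pose D := Y @^-1` `]a, b].
have mD : measurable D by rewrite -[X in measurable X]setTI; apply: mY.
have DE t : below b (Y t) - below a (Y t) = \1_D t.
  rewrite indicE /below; have -> : (t \in D) = (a < Y t <= b).
    by apply/idP/idP; rewrite inE /D /= in_itv.
  have [ya|ya] /= := leP (Y t) a; last by rewrite subr0.
  by rewrite (le_trans ya ab) subrr.
have PD : (P D < dl%:E)%E.
  rewrite -(fineK (fin_num_measure P D mD)) lte_fin.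
  have -> : fine (P D) = cdf b - cdf a.
    rewrite -ExB; [|exact: (LG_below1 b)|exact: (LG_below1 a)].
    rewrite /Ex (funext DE) /Rintegral; congr fine.
    by rewrite integral_indic// setIT.
  by rewrite (le_lt_trans _ cl)// distrC ler_norm.
apply/ltW/(le_lt_trans _ (dlP _ mD PD)).
have LD : L1 P (fun t => \1_D t * phi (Y t) (X t)).
  apply: (L1_bdM _ _ _ 1) => // t; by rewrite indicE ger0_norm// lern1 leq_b1.
have -> : G (fun y x => below b y * phi y x - below a y * phi y x) =
   Ex P (fun t => \1_D t * phi (Y t) (X t)).
  by congr (Ex P _); apply/funext => t; rewrite -DE mulrBl.
apply: (le_trans (le_normr_Rintegral measurableT LD)).
rewrite [X in _ <= X]Rintegral_mkcond; rewrite le_eqVlt; apply/orP; left; apply/eqP.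
apply: eq_Rintegral => t _.
by rewrite patchE /= indicE; case: ifP => _; rewrite ?mul1r ?mul0r ?normr0.
Qed.

(** The boundaries [qe e] themselves may fail to converge, but their [cdf] levels do, hence so do
    the integrals over half-lines. In the point-mass term the indicator at [y0] is eventually
    constant and its factor [e] tends to 0. *)
Lemma cvg_slice_mix (H : nat) (w : 'I_H -> R) (q : nat -> R) (qe : R -> nat -> R)
  (y0 : R) (x0 : 'cV[R]_p) (h : 'I_H) phi : (forall h, 0 < w h) ->
  valid_slicing G H q w ->
  (\forall e \near 0^'+, valid_slicing (mixexp G e y0 x0) H (qe e) w) -> LG phi ->
  mixexp G e y0 x0 (fun y x => slice_ind H (qe e) h y * phi y x) @[e --> 0^'+] -->
  G (fun y x => slice_ind H q h y * phi y x).
Proof.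
move=> w0 V V' L.
have e01 : \forall e \near (0 : R)^'+, 0 < e < 1.
  near=> e; apply/andP; split; near: e; [exact: nbhs_right_gt|exact: nbhs_right_lt].
have cb i : (i.+1 < H)%N ->
    G (fun y x => below (qe e i) y * phi y x) @[e --> 0^'+] -->
    G (fun y x => below (q i) y * phi y x).
  move=> iH; apply/cvgrPdist_le => eta eta0.
  have [dl dl0 dlP] := below_abscont _ _ L eta0.
  near=> e; rewrite distrC; apply: dlP.
  have ee : 0 < e < 1 by near: e.
  have Ve : valid_slicing (mixexp G e y0 x0) H (qe e) w by near: e.
  have := cdf_dist _ _ _ _ _ _ _ w0 V Ve ee _ iH.
  (* From $(1 - e) n \le e$ and $e < 1/2$ follows $n \le 2e$, which is below [dl] by the next
     bound. *)
  have e2 : e < 1 / 2 by near: e; apply: nbhs_right_lt; lra.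
  have e3 : e < dl / 2 by near: e; apply: nbhs_right_lt; lra.
  set n := `| _ |; have n0 : 0 <= n := normr_ge0 _.
  move: ee => /andP[e0 e1]; nra.
have ce : (e : R) @[e --> 0^'+] --> (0 : R) by apply: cvg_at_right_filter; exact: cvg_id.
have -> : G (fun y x => slice_ind H q h y * phi y x) =
  (1 - 0) * G (fun y x => slice_ind H q h y * phi y x) + 0 * (slice_ind H q h y0 * phi y0 x0).
  ring.
have cs : G (fun y x => slice_ind H (qe e) h y * phi y x) @[e --> 0^'+] -->
    G (fun y x => slice_ind H q h y * phi y x).
  rewrite slice_opE//; [|exact: linop_law|by case: V].
  have near_eq : {near 0^'+, (fun e =>
    (if h.+1 == H then G phi else G (fun y x => below (qe e h) y * phi y x)) -
    (if h == 0%N :> nat then 0 else G (fun y x => below (qe e h.-1) y * phi y x))) =1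
    (fun e => G (fun y x => slice_ind H (qe e) h y * phi y x))}.
    near=> e; rewrite slice_opE//; first exact: linop_law.
    have Ve : valid_slicing (mixexp G e y0 x0) H (qe e) w by near: e.
    by case: Ve.
  apply: (cvg_trans (near_eq_cvg near_eq)).
  apply: cvgB.
    case: eqP => [_|/eqP hH]; first exact: cvg_cst.
    by apply: cb; rewrite ltn_neqAle hH ltn_ord.
  case: eqP => [_|/eqP h0]; first exact: cvg_cst.
  by apply: cb; rewrite prednK ?ltn_ord// lt0n.
rewrite /mixexp; apply: cvgD.
  by apply: cvgM => //; apply: cvgB => //; exact: cvg_cst.
apply: cvgM => //; apply: cvg_near_cst.
near=> e.
have Ve : valid_slicing (mixexp G e y0 x0) H (qe e) w by near: e.
have ee : 0 < e < 1 by near: e.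
by rewrite (slice_ind_stable _ _ _ _ _ _ _ w0 V Ve ee).
Unshelve. all: by end_near. Qed.

End LinearOperators.

(** * Entrywise limits of products, determinants and inverses *)

Section MatrixLimits.
Context {R : realType} {I : Type} (F : set_system I) {FF : ProperFilter F}.

Lemma cvg_bigsum (J : Type) (s : seq J) (A : pred J) (f : J -> I -> R) (l : J -> R) :
  (forall j, f j e @[e --> F] --> l j) ->
  \sum_(j <- s | A j) f j e @[e --> F] --> \sum_(j <- s | A j) l j.
Proof.
move=> fl; elim: s => [|j s ih].
  under eq_fun do rewrite big_nil; rewrite big_nil; exact: cvg_cst.
under eq_fun do rewrite big_cons; rewrite big_cons.
by case: (A j) => //; apply: cvgD.
Qed.

Lemma cvg_bigprod (J : Type) (s : seq J) (f : J -> I -> R) (l : J -> R) :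
  (forall j, f j e @[e --> F] --> l j) ->
  \prod_(j <- s) f j e @[e --> F] --> \prod_(j <- s) l j.
Proof.
move=> fl; elim: s => [|j s ih].
  under eq_fun do rewrite big_nil; rewrite big_nil; exact: cvg_cst.
under eq_fun do rewrite big_cons; rewrite big_cons.
by apply: cvgM.
Qed.

Lemma cvg_det n (A : I -> 'M[R]_n) (B : 'M[R]_n) :
  (forall i j, A e i j @[e --> F] --> B i j) -> \det (A e) @[e --> F] --> \det B.
Proof.
move=> AB; apply: cvg_bigsum => s; apply: cvgM; first exact: cvg_cst.
exact: cvg_bigprod.
Qed.

Lemma cvg_mulmx m n r (A : I -> 'M[R]_(m, n)) (B : I -> 'M[R]_(n, r))
    (A0 : 'M[R]_(m, n)) (B0 : 'M[R]_(n, r)) :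
  (forall i j, A e i j @[e --> F] --> A0 i j) ->
  (forall i j, B e i j @[e --> F] --> B0 i j) ->
  forall i j, (A e *m B e) i j @[e --> F] --> (A0 *m B0) i j.
Proof.
move=> AA BB i j; rewrite mxE; under eq_fun do rewrite mxE.
by apply: cvg_bigsum => k; apply: cvgM.
Qed.

(** The adjugate formula is continuous where the determinant is nonzero. As [invmx] returns its
    argument on singular matrices, it obeys the formula only eventually. *)
Lemma cvg_invmx n (A : I -> 'M[R]_n) (B : 'M[R]_n) : B \in unitmx ->
  (forall i j, A e i j @[e --> F] --> B i j) ->
  (\forall e \near F, A e \in unitmx) /\
  forall i j, invmx (A e) i j @[e --> F] --> invmx B i j.
Proof.
move=> uB AB; have dB : \det B != 0 by rewrite -unitfE -unitmxE.
have cd := cvg_det _ _ _ AB.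
have uA : \forall e \near F, A e \in unitmx.
  near=> e; rewrite unitmxE unitfE; near: e.
  exact: (cvgr_neq0 _ cd dB).
split => // i j.
have : (\det (A e))^-1 * (\adj (A e)) i j @[e --> F] --> (\det B)^-1 * (\adj B) i j.
  apply: cvgM; first exact: cvgV.
  rewrite mxE; under eq_fun do rewrite mxE.
  apply: cvgM; first exact: cvg_cst.
  by apply: cvg_det => k l; rewrite !mxE; under eq_fun do rewrite !mxE; exact: AB.
rewrite [X in _ --> X](_ : _ = invmx B i j); last by rewrite /invmx uB [RHS]mxE.
apply: cvg_trans; apply: near_eq_cvg; near=> e.
have uAe : A e \in unitmx by near: e.
by rewrite /invmx uAe [RHS]mxE.
Unshelve. all: by end_near. Qed.

End MatrixLimits.

(** * Least squares within a slice *)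

Section SliceRegression.
Context {R : realType} {d : measure_display} {T : measurableType d} {p : nat}.
Variables (P : probability T R) (Y : T -> R) (X : T -> 'cV[R]_p).
Hypotheses (mY : measurable_fun setT Y)
  (mX : forall i, measurable_fun setT (fun t => X t i 0))
  (Y2 : P.-integrable setT (fun t => (Y t ^+ 2)%:E))
  (X2 : forall i, P.-integrable setT (fun t => (X t i 0 ^+ 2)%:E)).

Let LG := LG P Y X.
Let linop := linop P Y X.
Let L2Y c : L2 P (fun t => Y t - c).
Proof. by apply: L2B; [split|exact: L2_cst]. Qed.
Let L2X i c : L2 P (fun t => X t i 0 - c).
Proof. by apply: L2B; [split; [exact: mX|exact: X2]|exact: L2_cst]. Qed.

Lemma LG_Y c : LG (fun y _ => y - c).
Proof. by apply: L2_L1; exact: L2Y. Qed.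

Lemma LG_X i c : LG (fun _ x => x i 0 - c).
Proof. by apply: L2_L1; exact: L2X. Qed.

Lemma LG_XX i j a b : LG (fun _ x => (x i 0 - a) * (x j 0 - b)).
Proof. by apply: (L2_mulL1 P); exact: L2X. Qed.

Lemma LG_XY i a b : LG (fun y x => (x i 0 - a) * (y - b)).
Proof. by apply: (L2_mulL1 P); [exact: L2X|exact: L2Y]. Qed.

Section Op.
Variables (E : expop R p) (H : nat) (q : nat -> R) (h : 'I_H).
Hypotheses (LE : linop E) (w0 : sl_w E H q h != 0).
Let ind := slice_ind H q h.
Let w := sl_w E H q h.
Let muY := sl_muY E H q h.
Let mu := sl_mu E H q h.
Let S := sl_Sigma E H q h.
Let C := sl_cov E H q h.
Let b := sl_b E H q h.
Let ED := proj1 LE.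
Let EZ := proj2 LE.

Let Lind phi : LG phi -> LG (fun y x => ind y * phi y x).
Proof. exact: LG_slice. Qed.

Let Lind1 : LG (fun y _ => ind y).
Proof. exact: LG_slice1. Qed.

Let op_prod phi psi a c : LG phi -> LG psi -> LG (fun y x => phi y x * psi y x) ->
  E (fun y x => ind y * ((phi y x - a) * (psi y x - c))) =
  E (fun y x => ind y * (phi y x * psi y x)) - a * E (fun y x => ind y * psi y x)
  - c * E (fun y x => ind y * phi y x) + a * c * w.
Proof.
move=> L1 L2 L3.
have M1 := Lind _ L1; have M2 := Lind _ L2; have M3 := Lind _ L3.
rewrite -!EZ// -!(linopB P Y X)// -?ED//.
- by congr E; apply/funext => y; apply/funext => x; ring.
- by apply: L1B; [apply: L1B => //; exact: L1Z|exact: L1Z].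
- exact: (L1Z P (a * c)).
- by apply: L1B => //; exact: L1Z.
- exact: (L1Z P c).
- exact: (L1Z P a).
Qed.

Let op_sub phi c : LG phi ->
  E (fun y x => ind y * (phi y x - c)) = E (fun y x => ind y * phi y x) - c * w.
Proof.
move=> L; rewrite -EZ// -(linopB P Y X)//; last 2 first.
- exact: Lind.
- exact: (L1Z P c).
by congr E; apply/funext => y; apply/funext => x; ring.
Qed.

Lemma sl_muYE : E (fun y _ => ind y * y) = w * muY.
Proof. by rewrite /muY /sl_muY mulVKf. Qed.

Lemma sl_muE i : E (fun y x => ind y * x i 0) = w * mu i 0.
Proof. by rewrite /mu /sl_mu !mxE mulVKf. Qed.

Let LY : LG (fun y _ => y).
Proof. by have := LG_Y 0; under [fun y _ => _]eq_fun do under eq_fun do rewrite subr0. Qed.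
Let LX i : LG (fun _ x => x i 0).
Proof. by have := LG_X i 0; under [fun y _ => _]eq_fun do under eq_fun do rewrite subr0. Qed.

Lemma op_Yc : E (fun y _ => ind y * (y - muY)) = 0.
Proof. by rewrite (op_sub (fun y _ => y))// sl_muYE mulrC subrr. Qed.

Lemma op_Xc i : E (fun y x => ind y * (x i 0 - mu i 0)) = 0.
Proof. by rewrite (op_sub (fun _ x => x i 0))// sl_muE mulrC subrr. Qed.

Let LXX i j : LG (fun _ x => x i 0 * x j 0).
Proof.
by have := LG_XX i j 0 0; under [fun y _ => _]eq_fun do under eq_fun do rewrite !subr0.
Qed.
Let LXY i : LG (fun y x => x i 0 * y).
Proof.
by have := LG_XY i 0 0; under [fun y _ => _]eq_fun do under eq_fun do rewrite !subr0.
Qed.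

(** Raw-moment form: the function multiplying the slice indicator no longer involves the slice mean,
    which varies with the operator, so limits can be taken for a fixed function. *)
Lemma sl_SigmaE i j : S i j = w^-1 * E (fun y x => ind y * (x i 0 * x j 0)) - mu i 0 * mu j 0.
Proof.
rewrite /S /sl_Sigma mxE [X in _ * X]mxE -/mu -/w -/ind.
by rewrite (op_prod (fun _ x => x i 0) (fun _ x => x j 0))// !sl_muE; field.
Qed.

Lemma sl_covE i : C i 0 = w^-1 * E (fun y x => ind y * (x i 0 * y)) - mu i 0 * muY.
Proof.
rewrite /C /sl_cov mxE [X in _ * X]mxE -/mu -/w -/ind -/muY.
by rewrite (op_prod (fun _ x => x i 0) (fun y x => y))// sl_muE sl_muYE; field.
Qed.

Definition resid (y : R) (x : 'cV[R]_p) : R :=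
  y - sl_muY E H q h - dotv (sl_b E H q h) (x - sl_mu E H q h).

Lemma residE y x : resid y x = (y - muY) - \sum_j b j 0 * (x j 0 - mu j 0).
Proof. by rewrite /resid dotvE; congr (_ - _); apply: eq_bigr => j _; rewrite !mxE. Qed.

Lemma op_resid : E (fun y x => ind y * resid y x) = 0.
Proof.
have -> : (fun y x => ind y * resid y x) =
  (fun y x => ind y * (y - muY) - \sum_j b j 0 * (ind y * (x j 0 - mu j 0))).
  apply/funext => y; apply/funext => x; rewrite residE mulrBr mulr_sumr.
  by congr (_ - _); apply: eq_bigr => j _; ring.
have LX' j : LG (fun y x => ind y * (x j 0 - mu j 0)) by apply: Lind; exact: LG_X.
rewrite (linopB P Y X)//; last 2 first.
- by apply: (Lind (fun y _ => y - muY)); exact: LG_Y.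
- by apply: L1_sum => j; apply: L1Z; exact: LX'.
rewrite op_Yc (linop_sum P Y X)//; last by move=> j; apply: L1Z; exact: LX'.
rewrite big1 ?subrr// => j _.
by rewrite (EZ _ _ (LX' j)) op_Xc mulr0.
Qed.

(** Invertibility of [S] makes [b] a solution of $S b = C$, the least-squares equations. *)
Lemma op_X_resid i : S \in unitmx ->
  E (fun y x => ind y * ((x i 0 - mu i 0) * resid y x)) = 0.
Proof.
move=> uS.
have -> : (fun y (x : 'cV[R]_p) => ind y * ((x i 0 - mu i 0) * resid y x)) =
  (fun y x => ind y * ((x i 0 - mu i 0) * (y - muY)) -
     \sum_j b j 0 * (ind y * ((x i 0 - mu i 0) * (x j 0 - mu j 0)))).
  apply/funext => y; apply/funext => x; rewrite residE !mulrBr !mulr_sumr.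
  by congr (_ - _); apply: eq_bigr => j _; ring.
have LX' j : LG (fun y x => ind y * ((x i 0 - mu i 0) * (x j 0 - mu j 0))).
  by apply: Lind; exact: LG_XX.
rewrite (linopB P Y X)//; last 2 first.
- by apply: (Lind (fun y x => (x i 0 - mu i 0) * (y - muY))); exact: LG_XY.
- by apply: L1_sum => j; apply: L1Z; exact: LX'.
rewrite (linop_sum P Y X)//; last by move=> j; apply: L1Z; exact: LX'.
have -> : E (fun y x => ind y * ((x i 0 - mu i 0) * (y - muY))) = w * C i 0.
  by rewrite /C /sl_cov !mxE mulVKf.
have -> : C = S *m b by rewrite /b /sl_b mulKVmx.
rewrite mxE mulr_sumr -sumrB big1// => j _.
rewrite (EZ _ _ (LX' j)).
have -> : E (fun y x => ind y * ((x i 0 - mu i 0) * (x j 0 - mu j 0))) = w * S i j.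
  by rewrite /S /sl_Sigma !mxE mulVKf.
by ring.
Qed.

(** The centring [c] is free because changing it adds a multiple of the mean residual, which is 0.
    It will be taken as the global mean of [X]. *)
Lemma normal_eq (v c : 'cV[R]_p) : S \in unitmx ->
  E (fun y x => ind y * (dotv v (x - c) * resid y x)) = 0.
Proof.
move=> uS.
have -> : (fun y (x : 'cV[R]_p) => ind y * (dotv v (x - c) * resid y x)) =
  (fun y x => \sum_i v i 0 * (ind y * ((x i 0 - mu i 0) * resid y x)) +
     dotv v (mu - c) * (ind y * resid y x)).
  apply/funext => y; apply/funext => x.
  have -> : dotv v (x - c) = (\sum_i v i 0 * (x i 0 - mu i 0)) + dotv v (mu - c).
    have -> : dotv v (x - c) = dotv v (x - mu) + dotv v (mu - c).
      by rewrite -dotvDr addrA subrK.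
    congr (_ + _); rewrite dotvE; apply: eq_bigr => i _.
    by rewrite !mxE.
  rewrite mulrDl mulrDr mulr_suml mulr_sumr; congr (_ + _); last by ring.
  by apply: eq_bigr => i _; ring.
have rF : resid = fun y x => (y - muY) - \sum_j b j 0 * (x j 0 - mu j 0).
  by apply/funext => y; apply/funext => x; exact: residE.
have Lr : LG (fun y x => ind y * resid y x).
  apply: Lind; rewrite rF.
  apply: (L1B P); first exact: LG_Y.
  by apply: L1_sum => j; apply: L1Z; exact: LG_X.
have Lxr i : LG (fun y x => ind y * ((x i 0 - mu i 0) * resid y x)).
  apply: Lind; rewrite rF.
  apply: L2_mulL1; first exact: L2X.
  apply: L2B; first exact: L2Y.
  by apply: L2_sum => j; apply: L2Z; exact: L2X.
rewrite ED; [|by apply: L1_sum => i; apply: L1Z; exact: Lxr|exact: L1Z].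
rewrite (linop_sum P Y X)//; last by move=> i; apply: L1Z; exact: Lxr.
rewrite (EZ _ _ Lr) op_resid mulr0 addr0 big1// => i _.
by rewrite (EZ _ _ (Lxr i)) op_X_resid// mulr0.
Qed.

End Op.

Let G := law_exp P Y X.

(** * Convergence of the within-slice quantities as the contamination vanishes *)

Section Limits.
Variables (H : nat) (w : 'I_H -> R) (q : nat -> R) (qe : R -> nat -> R).
Variables (y0 : R) (x0 : 'cV[R]_p) (h : 'I_H).
Hypotheses (w0 : forall h, 0 < w h) (V : valid_slicing G H q w)
  (V' : \forall e \near 0^'+, valid_slicing (mixexp G e y0 x0) H (qe e) w)
  (uS : sl_Sigma G H q h \in unitmx).
Let Ge e := mixexp G e y0 x0.

Let cvs phi : LG phi ->
  Ge e (fun y x => slice_ind H (qe e) h y * phi y x) @[e --> 0^'+] -->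
  G (fun y x => slice_ind H q h y * phi y x).
Proof. exact: cvg_slice_mix. Qed.

Let wG : sl_w G H q h != 0.
Proof. by have [_ ->] := V; rewrite gt_eqF. Qed.

Let wGe : \forall e \near 0^'+, sl_w (Ge e) H (qe e) h = w h.
Proof. by apply: filterS V' => e [_ ->]. Qed.

Let cvw : sl_w (Ge e) H (qe e) h @[e --> 0^'+] --> sl_w G H q h.
Proof. by have [_ ->] := V; exact: cvg_near_cst. Qed.

Lemma cvg_sl_muY : sl_muY (Ge e) H (qe e) h @[e --> 0^'+] --> sl_muY G H q h.
Proof.
apply: cvgM; first exact: cvgV.
apply: (cvs (fun y _ => y)); have := LG_Y 0.
by under [fun y _ => _]eq_fun do under eq_fun do rewrite subr0.
Qed.

Lemma cvg_sl_mu i : sl_mu (Ge e) H (qe e) h i 0 @[e --> 0^'+] --> sl_mu G H q h i 0.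
Proof.
rewrite !mxE; under eq_fun do rewrite !mxE.
apply: cvgM; first exact: cvgV.
apply: (cvs (fun _ x => x i 0)); have := LG_X i 0.
by under [fun y _ => _]eq_fun do under eq_fun do rewrite subr0.
Qed.

Lemma cvg_sl_Sigma i j :
  sl_Sigma (Ge e) H (qe e) h i j @[e --> 0^'+] --> sl_Sigma G H q h i j.
Proof.
rewrite sl_SigmaE//; last exact: linop_law.
have : (sl_w (Ge e) H (qe e) h)^-1 *
   Ge e (fun y x => slice_ind H (qe e) h y * (x i 0 * x j 0)) -
   sl_mu (Ge e) H (qe e) h i 0 * sl_mu (Ge e) H (qe e) h j 0 @[e --> 0^'+] -->
   (sl_w G H q h)^-1 * G (fun y x => slice_ind H q h y * (x i 0 * x j 0)) -
   sl_mu G H q h i 0 * sl_mu G H q h j 0.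
  apply: cvgB; last by apply: cvgM; exact: cvg_sl_mu.
  apply: cvgM; first exact: cvgV.
  apply: (cvs (fun _ x => x i 0 * x j 0)); have := LG_XX i j 0 0.
  by under [fun y _ => _]eq_fun do under eq_fun do rewrite !subr0.
apply: cvg_trans; apply: near_eq_cvg; near=> e.
rewrite sl_SigmaE//; first exact: linop_mix.
have -> : sl_w (Ge e) H (qe e) h = w h by near: e.
by rewrite gt_eqF.
Unshelve. all: by end_near. Qed.

Lemma cvg_sl_cov i :
  sl_cov (Ge e) H (qe e) h i 0 @[e --> 0^'+] --> sl_cov G H q h i 0.
Proof.
rewrite sl_covE//; last exact: linop_law.
have : (sl_w (Ge e) H (qe e) h)^-1 *
   Ge e (fun y x => slice_ind H (qe e) h y * (x i 0 * y)) -
   sl_mu (Ge e) H (qe e) h i 0 * sl_muY (Ge e) H (qe e) h @[e --> 0^'+] -->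
   (sl_w G H q h)^-1 * G (fun y x => slice_ind H q h y * (x i 0 * y)) -
   sl_mu G H q h i 0 * sl_muY G H q h.
  apply: cvgB; last by apply: cvgM; [exact: cvg_sl_mu|exact: cvg_sl_muY].
  apply: cvgM; first exact: cvgV.
  apply: (cvs (fun y x => x i 0 * y)); have := LG_XY i 0 0.
  by under [fun y _ => _]eq_fun do under eq_fun do rewrite !subr0.
apply: cvg_trans; apply: near_eq_cvg; near=> e.
rewrite sl_covE//; first exact: linop_mix.
have -> : sl_w (Ge e) H (qe e) h = w h by near: e.
by rewrite gt_eqF.
Unshelve. all: by end_near. Qed.

Lemma sl_Sigma_near_unit : \forall e \near 0^'+, sl_Sigma (Ge e) H (qe e) h \in unitmx.
Proof. by have [] := cvg_invmx _ _ _ _ uS cvg_sl_Sigma. Qed.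

Lemma cvg_sl_b i : sl_b (Ge e) H (qe e) h i 0 @[e --> 0^'+] --> sl_b G H q h i 0.
Proof.
apply: cvg_mulmx => [k l|k l].
  by have [_] := cvg_invmx _ _ _ _ uS cvg_sl_Sigma; exact.
rewrite ord1; exact: cvg_sl_cov.
Qed.

Lemma cvg_resid : resid (Ge e) H (qe e) h y0 x0 @[e --> 0^'+] --> resid G H q h y0 x0.
Proof.
rewrite residE; under eq_fun do rewrite residE.
apply: cvgB; first by apply: cvgB; [exact: cvg_cst|exact: cvg_sl_muY].
apply: cvg_bigsum => j; apply: cvgM; first exact: cvg_sl_b.
by apply: cvgB; [exact: cvg_cst|exact: cvg_sl_mu].
Qed.

End Limits.
End SliceRegression.

Lemma cvg_dotv {R : realType} {I : Type} (F : set_system I) {FF : ProperFilter F} {p}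
    (u v : I -> 'cV[R]_p) (u0 v0 : 'cV[R]_p) :
  (forall i, u e i 0 @[e --> F] --> u0 i 0) ->
  (forall i, v e i 0 @[e --> F] --> v0 i 0) ->
  dotv (u e) (v e) @[e --> F] --> dotv u0 v0.
Proof.
move=> cu cv; rewrite dotvE; under eq_fun do rewrite dotvE.
by apply: cvg_bigsum => i; apply: cvgM.
Qed.

Lemma cvg_eq {R : realType} {I : Type} (F : set_system I) {FF : ProperFilter F}
    (u : I -> R) (a b : R) : u @ F --> a -> u @ F --> b -> a = b.
Proof. by move=> ua ub; exact: (cvg_unique _ ua ub). Qed.

Lemma dotv_swar {R : realType} {p} (E : expop R p) H q (a v : 'cV[R]_p) :
  dotv a (swar E H q *m v) =
  \sum_(h < H) sl_w E H q h * (dotv a (sl_b E H q h) * dotv (sl_b E H q h) v).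
Proof.
rewrite /swar mulmx_suml dotv_sumr; apply: eq_bigr => h _.
rewrite -scalemxAl dotvZr; congr (_ * _).
rewrite -mulmxA {1}/dotv mulmxA mxE big_ord1; congr (_ * _).
Qed.

(** * Exact normal equations at the contaminated distribution *)

Section Influence.
Context {R : realType} {d : measure_display} {T : measurableType d} {p : nat}.
Variables (P : probability T R) (Y : T -> R) (X : T -> 'cV[R]_p) (eps : T -> R).
Variables (f : R -> R -> R) (beta : 'cV[R]_p).
Hypotheses (mY : measurable_fun setT Y)
  (mX : forall i, measurable_fun setT (fun t => X t i 0))
  (meps : measurable_fun setT eps)
  (mf : measurable_fun setT (fun z : R * R => f z.1 z.2))
  (Y2 : P.-integrable setT (fun t => (Y t ^+ 2)%:E))
  (X2 : forall i, P.-integrable setT (fun t => (X t i 0 ^+ 2)%:E))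
  (posdef : forall v : 'cV[R]_p, v != 0 -> 0 < (v^T *m law_cov P Y X *m v) 0 0)
  (beta0 : beta != 0)
  (Yf : forall t, Y t = f ((beta^T *m X t) 0 0) (eps t))
  (indep : indep_vec P eps X)
  (lin : forall b : 'cV[R]_p, exists a0 a1 : R,
     is_condexp P (fun t => (beta^T *m X t) 0 0) (fun t => (b^T *m X t) 0 0)
       (fun z => a0 + a1 * z))
  (cvar : exists (m : R -> 'cV[R]_p) (V : 'M[R]_p),
     (forall i, is_condexp P (fun t => (beta^T *m X t) 0 0)
                  (fun t => X t i 0) (fun z => m z i 0)) /\
     (forall i j, is_condexp P (fun t => (beta^T *m X t) 0 0)
        (fun t => (X t i 0 - m ((beta^T *m X t) 0 0) i 0) *
                  (X t j 0 - m ((beta^T *m X t) 0 0) j 0))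
        (fun _ => V i j))).

Let G := law_exp P Y X.
Let mu : 'cV[R]_p := law_mean P Y X.
Let Sig : 'M[R]_p := law_cov P Y X.
Let Z t := dotv beta (X t).
Local Notation xi := (centered P Y X).

Let L2xi b : L2 P (xi b). Proof. exact: L2_xi. Qed.
Let L2Y k : L2 P (fun t => Y t - k).
Proof. by apply: L2B; [split|exact: L2_cst]. Qed.
Let uSig : Sig \in unitmx. Proof. exact: Sig_unit. Qed.

Let gxi (g : R * R -> R) b : dotv b (Sig *m beta) = 0 ->
  measurable_fun setT g -> L1 P (fun t => g (Y t, Z t) * xi b t) ->
  Ex P (fun t => g (Y t, Z t) * xi b t) = 0.
Proof. by move=> bb mg L; apply: (@Ex_g_xi R d T p P Y X eps f beta) => //. Qed.

Let gxixi (g : R * R -> R) b c k : dotv b (Sig *m beta) = 0 ->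
  measurable_fun setT g -> (forall z, `|g z| <= k) ->
  Ex P (fun t => g (Y t, Z t) * (xi b t * xi c t)) =
  dotv b (Sig *m c) * Ex P (fun t => g (Y t, Z t)).
Proof.
by move=> bb mg gk; apply: (@Ex_bd_xixi R d T p P Y X eps f beta _ _ _ _ _ _ _ _ _ _ _ g b c k).
Qed.

(** The term in $Y - k$ is a function of $Y$ times [xi b] and has mean 0; the quadratic term
    factors. The boundaries [q] are arbitrary and enter the value only through the slice mass. *)
Lemma Ex_slice_xi_resid H q (h : 'I_H) b c k : dotv b (Sig *m beta) = 0 ->
  Ex P (fun t => slice_ind H q h (Y t) * (xi b t * (Y t - k - xi c t))) =
  - dotv b (Sig *m c) * sl_w G H q h.
Proof.
move=> bb; pose ind := slice_ind H q h.
have mind : measurable_fun setT (fun z : R * R => ind z.1).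
  by apply: measurableT_comp => //; exact: measurable_slice_ind.
have mindY : measurable_fun setT (fun t => ind (Y t)).
  by apply: measurableT_comp => //; exact: measurable_slice_ind.
have ind1 y : `|ind y| <= 1 by exact: slice_ind_norm.
have -> : (fun t => ind (Y t) * (xi b t * (Y t - k - xi c t))) =
   (fun t => (ind (Y t) * (Y t - k)) * xi b t - ind (Y t) * (xi b t * xi c t)).
  by apply/funext => t; ring.
have L1a : L1 P (fun t => (ind (Y t) * (Y t - k)) * xi b t).
  by apply: L2_mulL1 => //; apply: (@L2_bdM _ _ _ _ _ _ 1) => //.
have L1b : L1 P (fun t => ind (Y t) * (xi b t * xi c t)).
  by apply: (@L1_bdM _ _ _ _ _ _ 1) => //; apply: L2_mulL1.
rewrite ExB// (gxi (fun z => ind z.1 * (z.1 - k)))//; last first.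
  by apply: measurable_funM => //; exact: measurable_funB.
by rewrite (gxixi (fun z => ind z.1) b c 1)// sub0r mulNr.
Qed.

(** The normal equation tested against $b^T(x - \mu)$ splits into its part under the law, computed
    exactly, and the point-mass part. The contaminated slice mass minus the contribution of [y0] is
    $1 - e$ times the mass under the law. *)
Lemma perturbed_normal_eq e y0 x0 H q (h : 'I_H) b :
  let E := mixexp G e y0 x0 in
  sl_w E H q h != 0 -> sl_Sigma E H q h \in unitmx -> dotv b (Sig *m beta) = 0 ->
  (sl_w E H q h - e * slice_ind H q h y0) * dotv b (Sig *m sl_b E H q h) =
  e * (slice_ind H q h y0 * (dotv b (x0 - mu) * resid E H q h y0 x0)).
Proof.
move=> E w0 uS bb.
have LE : linop P Y X E by exact: linop_mix.
have := normal_eq P Y X mY mX Y2 X2 E H q h LE w0 b mu uS.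
rewrite {1}/E /mixexp.
set bh := sl_b E H q h.
(* Absorbs the contaminated slice means, so that the residual reads $Y - k - b_h^T(X - \mu)$ with
   the global mean. *)
pose k := sl_muY E H q h + dotv bh (mu - sl_mu E H q h).
have -> : G (fun y x => slice_ind H q h y * (dotv b (x - mu) * resid E H q h y x)) =
    Ex P (fun t => slice_ind H q h (Y t) * (xi b t * (Y t - k - xi bh t))).
  congr (Ex P _); apply/funext => t; rewrite /resid -/bh /k /centered -/mu.
  congr (_ * (_ * _)).
  have -> : dotv bh (X t - sl_mu E H q h) = dotv bh (X t - mu) + dotv bh (mu - sl_mu E H q h).
    by rewrite -dotvDr addrA subrK.
  by rewrite opprD addrA; lra.
rewrite Ex_slice_xi_resid//.
have -> : sl_w E H q h = (1 - e) * sl_w G H q h + e * slice_ind H q h y0 by [].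
set A := slice_ind _ _ _ _ * _ => h0.
have -> : e * A = (1 - e) * (dotv b (Sig *m bh) * sl_w G H q h).
  by rewrite -[RHS]addr0 -h0; ring.
ring.
Qed.

Lemma mix0 y0 x0 : mixexp G 0 y0 x0 = G.
Proof. by apply/funext => phi; rewrite /mixexp subr0 mul1r mul0r addr0. Qed.

(** The case [e = 0] of the perturbed equation, with an arbitrary contamination point. *)
Lemma sl_b_perp H q (h : 'I_H) b : sl_w G H q h != 0 -> sl_Sigma G H q h \in unitmx ->
  dotv b (Sig *m beta) = 0 -> dotv b (Sig *m sl_b G H q h) = 0.
Proof.
move=> w0 uS bb; have := perturbed_normal_eq 0 0 0 H q h b.
rewrite mix0 => /(_ w0 uS bb); rewrite !mul0r subr0 => /eqP.
by rewrite mulf_eq0 (negbTE w0) => /eqP.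
Qed.

(** Converts orthogonality of [a] to [beta] into $\Sigma$-orthogonality of $\Sigma^{-1} a$. *)
Lemma Sig_inv_dot a c : dotv (invmx Sig *m a) (Sig *m c) = dotv a c.
Proof.
have := Sig_sym P Y X; rewrite -/Sig => sS.
by rewrite dotv_mulmx sS mulmxA mulmxV// mul1mx.
Qed.

(** * The slice slopes and the leading eigenvector lie along [beta] *)

Section Direction.
Variables (H : nat) (w : 'I_H -> R) (q : nat -> R) (g : 'cV[R]_p) (lam : R).
Hypotheses (w0 : forall h, 0 < w h) (V : valid_slicing G H q w)
  (uS : forall h, sl_Sigma G H q h \in unitmx) (lam0 : 0 < lam)
  (gE : top_unit_eigvec (swar G H q) lam g).

Let wG h : sl_w G H q h = w h. Proof. by have [_ ->] := V. Qed.
Let wG0 h : sl_w G H q h != 0. Proof. by rewrite wG gt_eqF. Qed.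
Let gg : dotv g g = 1. Proof. by have [] := gE. Qed.

Lemma perp_sl_b a h : dotv a beta = 0 -> dotv a (sl_b G H q h) = 0.
Proof.
by move=> ab; rewrite -Sig_inv_dot; apply: sl_b_perp => //; rewrite Sig_inv_dot.
Qed.

(** Pairing the eigenvalue equation with [a] gives $\lambda_1 a^T g = 0$, since all slopes are
    orthogonal to [a]; then $\lambda_1 > 0$ is used. *)
Lemma perp_beta_dir a : dotv a beta = 0 -> dotv a g = 0.
Proof.
move=> ab; have [_ [ge _]] := gE.
have := congr1 (dotv a) ge; rewrite dotv_swar dotvZr big1; last first.
  by move=> h _; rewrite perp_sl_b// mul0r mulr0.
by move=> /esym/eqP; rewrite mulf_eq0 gt_eqF//= => /eqP.
Qed.

(** The residual of projecting [c] on [beta] is orthogonal to [beta] and to [c], hence to itself. *)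
Let colinear c : (forall a, dotv a beta = 0 -> dotv a c = 0) ->
  c = (dotv c beta / dotv beta beta) *: beta.
Proof.
have bb : dotv beta beta != 0 by rewrite dotv_eq0.
move=> perp; set s := _ / _; pose a := c - s *: beta.
have ab : dotv a beta = 0 by rewrite dotvBl dotvZl divfK// subrr.
have : dotv a a == 0 by rewrite {2}/a dotvBr dotvZr ab (perp _ ab) mulr0 subrr.
by rewrite dotv_eq0 subr_eq0 => /eqP.
Qed.

Lemma dir_colinear : exists2 s, s != 0 & g = s *: beta.
Proof.
have gs := colinear _ perp_beta_dir.
exists (dotv g beta / dotv beta beta) => //.
apply/eqP => s0; have := gg; rewrite gs s0 scale0r dotv0l => /esym/eqP.
by rewrite oner_eq0.
Qed.

Lemma perp_dir_beta a : dotv a g = 0 -> dotv a beta = 0.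
Proof.
have [s s0 ->] := dir_colinear; rewrite dotvZr => /eqP.
by rewrite mulf_eq0 (negbTE s0) => /eqP.
Qed.

Lemma lam_sum : lam = \sum_(h < H) w h * (dotv g (sl_b G H q h) * dotv (sl_b G H q h) g).
Proof.
have [_ [ge _]] := gE; have := congr1 (dotv g) ge.
rewrite dotv_swar dotvZr gg mulr1 => <-.
by apply: eq_bigr => h _; rewrite wG.
Qed.

(** * The influence function at a fixed contamination point *)

Section Limit.
Variables (qe : R -> nat -> R) (ve : R -> 'cV[R]_p) (y0 : R) (x0 IF : 'cV[R]_p).
Let Ge e := mixexp G e y0 x0.
Hypotheses (V' : \forall e \near 0^'+, valid_slicing (Ge e) H (qe e) w)
  (eig : \forall e \near 0^'+, exists l, top_unit_eigvec (swar (Ge e) H (qe e)) l (ve e))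
  (cvIF : e^-1 *: (ve e - g) @[e --> 0^'+] --> IF).

Let ue e : 'cV[R]_p := e^-1 *: (ve e - g).
Let be e h := sl_b (Ge e) H (qe e) h.

Let cvu i : ue e i 0 @[e --> 0^'+] --> IF i 0.
Proof.
exact: (@cvg_comp _ _ _ ue (fun M : 'cV[R]_p => M i 0) _ _ _ cvIF (@coord_continuous _ _ _ i 0 IF)).
Qed.

Let cve : (e : R) @[e --> 0^'+] --> (0 : R).
Proof. by apply: cvg_at_right_filter; exact: cvg_id. Qed.

Let epos : \forall e \near (0 : R)^'+, 0 < e.
Proof. exact: nbhs_right_gt. Qed.

Let veE (e : R) : 0 < e -> ve e = g + e *: ue e.
Proof. by move=> e0; rewrite /ue scalerA divff ?gt_eqF// scale1r addrC subrK. Qed.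

(** A convergent difference quotient forces [ve e] to tend to [g]; this also settles the sign of the
    contaminated eigenvectors. *)
Let cvv i : ve e i 0 @[e --> 0^'+] --> g i 0.
Proof.
have : g i 0 + e * ue e i 0 @[e --> 0^'+] --> g i 0 + 0 * IF i 0.
  by apply: cvgD; [exact: cvg_cst|exact: cvgM].
rewrite mul0r addr0; apply: cvg_trans; apply: near_eq_cvg; near=> e.
have e0 : 0 < e by near: e.
by move: (ue e) (veE _ e0) => u ->; rewrite !mxE.
Unshelve. all: by end_near. Qed.

Let cvb h i : be e h i 0 @[e --> 0^'+] --> sl_b G H q h i 0.
Proof. by apply: (@cvg_sl_b R d T p P Y X mY mX Y2 X2 H w). Qed.

(** Both eigenvectors have norm 1, so $2 g^T u + e\, u^T u = 0$ for the difference quotient $u$; let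
    $e \to 0$. *)
Lemma IF_dot_dir : dotv g IF = 0.
Proof.
have c0 : 2 * dotv g (ue e) + e * dotv (ue e) (ue e) @[e --> 0^'+] -->
    2 * dotv g IF + 0 * dotv IF IF.
  apply: cvgD; apply: cvgM => //; first exact: cvg_cst.
    by apply: cvg_dotv => // i; exact: cvg_cst.
  exact: cvg_dotv.
have c1 : 2 * dotv g (ue e) + e * dotv (ue e) (ue e) @[e --> 0^'+] --> (0 : R).
  apply: cvg_near_cst; near=> e.
  have e0 : 0 < e by near: e.
  have [l [v1 _]] : exists l, top_unit_eigvec (swar (Ge e) H (qe e)) l (ve e) by near: e.
  have : dotv (ve e) (ve e) = 1 by [].
  move: (ue e) (veE _ e0) => u ->.
  rewrite dotvDl !dotvDr !dotvZl !dotvZr gg (dotvC u g) => h.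
  apply: (mulfI (lt0r_neq0 e0)); rewrite mulr0.
  move: (dotv g u) (dotv u u) h => A B h.
  by rewrite mulrDr; lra.
have E : 2 * dotv g IF + 0 * dotv IF IF = 0 by exact: (cvg_eq _ _ _ _ c0 c1).
move: E; rewrite mul0r addr0 => E; lra.
Unshelve. all: by end_near. Qed.

(** The contaminated eigenvalue equation is paired with [a]. Its left side is $e$ times eigenvalue
    times $a^T u$, and on the right each $a^T b_h(e)$ is explicit and proportional to $e$. Dividing
    by $e$ and passing to the limit needs only convergence of the slopes, not a derivative of the
    SWAR matrix. *)
Lemma IF_perp a : dotv a g = 0 ->
  lam * dotv a IF = (\sum_(h < H) slice_ind H q h y0 * resid G H q h y0 x0
     * dotv (sl_b G H q h) g) * dotv (invmx Sig *m a) (x0 - mu).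
Proof.
move=> ag; have ab := perp_dir_beta _ ag.
pose b := invmx Sig *m a; have bb : dotv b (Sig *m beta) = 0 by rewrite Sig_inv_dot.
(* The contaminated eigenvalue written as a Rayleigh quotient, whose limit follows from those of the
   slopes and of [ve e]. *)
pose le e := \sum_(h < H) w h * (dotv (ve e) (be e h) * dotv (be e h) (ve e)).
have cl : le e @[e --> 0^'+] --> lam.
  rewrite lam_sum; apply: cvg_bigsum => h; apply: cvgM; first exact: cvg_cst.
  by apply: cvgM; apply: cvg_dotv.
(* The value of $w_h a^T b_h(e) / e$ obtained by solving the perturbed normal equation; its first
   two factors have a product tending to 1. *)
pose K e h := w h * (w h - e * slice_ind H q h y0)^-1 *
  (slice_ind H q h y0 * (dotv b (x0 - mu) * resid (Ge e) H (qe e) h y0 x0)).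
have c0 : le e * dotv a (ue e) @[e --> 0^'+] --> lam * dotv a IF.
  by apply: cvgM => //; apply: cvg_dotv => // i; exact: cvg_cst.
have c1 : \sum_(h < H) K e h * dotv (be e h) (ve e) @[e --> 0^'+] -->
    \sum_(h < H) (slice_ind H q h y0 * (dotv b (x0 - mu) * resid G H q h y0 x0)) *
      dotv (sl_b G H q h) g.
  apply: cvg_bigsum => h; apply: cvgM; last exact: cvg_dotv.
  rewrite -[X in _ --> X]mul1r; apply: cvgM.
    have -> : (1 : R) = w h * (w h - 0 * slice_ind H q h y0)^-1.
      by rewrite mul0r subr0 divff// gt_eqF.
    apply: cvgM; first exact: cvg_cst.
    apply: cvgV; first by rewrite mul0r subr0 gt_eqF.
    by apply: cvgB; [exact: cvg_cst|apply: cvgM => //; exact: cvg_cst].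
  apply: cvgM; first exact: cvg_cst.
  apply: cvgM; first exact: cvg_cst.
  by apply: (@cvg_resid R d T p P Y X mY mX Y2 X2 H w).
have c2 : le e * dotv a (ue e) @[e --> 0^'+] -->
    \sum_(h < H) (slice_ind H q h y0 * (dotv b (x0 - mu) * resid G H q h y0 x0)) *
      dotv (sl_b G H q h) g.
  apply: cvg_trans c1; apply: near_eq_cvg.
  have uSe : \forall e \near 0^'+, forall h, sl_Sigma (Ge e) H (qe e) h \in unitmx.
    apply: filter_forall => h.
    by apply: (@sl_Sigma_near_unit R d T p P Y X mY mX X2 H w q).
  (* Keeps the denominators in [K] nonzero. *)
  have ew : \forall e \near (0 : R)^'+, forall h, e < w h.
    by apply: filter_forall => h; exact: nbhs_right_lt.
  near=> e.
  have e0 : 0 < e by near: e.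
  have e1 : e < 1 by near: e; exact: nbhs_right_lt.
  have [l [v1 [vl _]]] : exists l, top_unit_eigvec (swar (Ge e) H (qe e)) l (ve e) by near: e.
  have Ve : valid_slicing (Ge e) H (qe e) w by near: e.
  have uSe' : forall h, sl_Sigma (Ge e) H (qe e) h \in unitmx by near: e.
  have ewh : forall h, e < w h by near: e.
  have we h : sl_w (Ge e) H (qe e) h = w h by have [_ ->] := Ve.
  have swE c : dotv c (swar (Ge e) H (qe e) *m ve e) =
      \sum_(h < H) w h * (dotv c (be e h) * dotv (be e h) (ve e)).
    by rewrite dotv_swar; apply: eq_bigr => h _; rewrite we.
  have lE : le e = l.
    rewrite /le -swE vl dotvZr.
    have -> : dotv (ve e) (ve e) = 1 by [].
    by rewrite mulr1.
  apply: (mulfI (lt0r_neq0 e0)).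
  have <- : l * dotv a (ve e) = e * (le e * dotv a (ue e)).
    by rewrite (veE _ e0) dotvDr ag add0r dotvZr lE; ring.
  rewrite -dotvZr -vl swE mulr_sumr; apply: eq_bigr => h _.
  rewrite !mulrA; congr (_ * _).
  have ie : slice_ind H (qe e) h y0 = slice_ind H q h y0.
    apply: (@slice_ind_stable R d T p P Y X mY H w q (qe e) e y0 x0) => //.
    by rewrite e0 e1.
  have pw : w h - e * slice_ind H q h y0 != 0.
    rewrite subr_eq0 gt_eqF//.
    have /andP[i0 i1] := slice_ind01 H q h y0.
    apply: le_lt_trans (ewh h); apply: ler_piMr => //; exact: ltW.
  have := perturbed_normal_eq e y0 x0 H (qe e) h b.
  rewrite /= -/(Ge e) we ie => /(_ (lt0r_neq0 (w0 h)) (uSe' h) bb).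
  rewrite Sig_inv_dot -/(be e h) => KE.
  have -> : dotv a (be e h) = (w h - e * slice_ind H q h y0)^-1 *
    (e * (slice_ind H q h y0 * (dotv b (x0 - mu) * resid (Ge e) H (qe e) h y0 x0))).
    by rewrite -KE mulKf.
  by rewrite /K; ring.
rewrite (cvg_eq _ _ _ _ c0 c2) mulr_suml.
by apply: eq_bigr => h _; rewrite -/b; ring.
Unshelve. all: by end_near. Qed.

End Limit.

(** * The scalar factor of the influence function and its second moment *)

Let score y x := \sum_(h < H) slice_ind H q h y * resid G H q h y x * dotv (sl_b G H q h) g.

(** Each $b_h$ is this multiple of [beta], so residuals, and with them [score], are functions of
    $(Y, \beta^T X)$; [kappa] is that function. *)
Let slope h := dotv (sl_b G H q h) beta / dotv beta beta.
Let res (h : 'I_H) (z : R * R) : R :=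
  z.1 - sl_muY G H q h - slope h * (z.2 - dotv beta (sl_mu G H q h)).
Let term (h : 'I_H) (z : R * R) : R :=
  slice_ind H q h z.1 * res h z * dotv (sl_b G H q h) g.
Let kappa z := \sum_(h < H) term h z.

Let residZ h t : resid G H q h (Y t) (X t) = res h (Y t, Z t).
Proof.
rewrite /resid /res /=; congr (_ - _).
rewrite [sl_b G H q h](colinear _ (fun a ab => perp_sl_b a h ab)).
by rewrite dotvZl dotvBr.
Qed.

Let scoreE t : score (Y t) (X t) = kappa (Y t, Z t).
Proof. by apply: eq_bigr => h _; rewrite /term residZ. Qed.

Let L2_index : L2 P Z. Proof. exact: (L2_Z P Y X beta mX X2). Qed.

Let L2res h : L2 P (fun t => res h (Y t, Z t)).
Proof.
rewrite /res /=; apply: L2B => //; apply: L2Z; apply: L2B => //.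
exact: L2_cst.
Qed.

Let mindY (h : 'I_H) : measurable_fun setT (fun t => slice_ind H q h (Y t)).
Proof. by apply: measurableT_comp => //; exact: measurable_slice_ind. Qed.

Let L2term h : L2 P (fun t => term h (Y t, Z t)).
Proof.
rewrite /term /=; under [fun t => _]eq_fun do rewrite mulrC.
apply: L2Z; apply: (@L2_bdM _ _ _ _ _ _ 1) => //.
by move=> t; exact: slice_ind_norm.
Qed.

Let mkappa : measurable_fun setT kappa.
Proof.
apply: measurable_sum => h; apply: measurable_funM => //.
apply: measurable_funM.
  by apply: (measurableT_comp (measurable_slice_ind H q h)).
apply: measurable_funB; first exact: measurable_funB.
by apply: measurable_funM => //; exact: measurable_funB.
Qed.

(** Disjointness of the slices removes the cross terms of the square. *)
Let Ex_kappa2 : Ex P (fun t => kappa (Y t, Z t) ^+ 2) =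
  \sum_(h < H) w h * dotv (sl_b G H q h) g ^+ 2 * sl_ER2 G H q h.
Proof.
have E t : kappa (Y t, Z t) ^+ 2 = \sum_(h < H) term h (Y t, Z t) ^+ 2.
  rewrite expr2 /kappa mulr_suml; apply: eq_bigr => h _.
  rewrite mulr_sumr (bigD1 h)//= big1 ?addr0// => k kh.
  rewrite /term /= mulrACA [X in X * _]mulrACA slice_ind_disj ?mul0r//.
  - by case: V.
  - by rewrite eq_sym.
rewrite (funext E) Ex_sum; last by move=> h; exact: (L2term h).2.
apply: eq_bigr => h _.
have L : L1 P (fun t => slice_ind H q h (Y t) * resid G H q h (Y t) (X t) ^+ 2).
  under [fun t => _]eq_fun do rewrite residZ.
  apply: (@L1_bdM _ _ _ _ _ _ 1) => //; last exact: (L2res h).2.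
  by move=> t; exact: slice_ind_norm.
have -> : (fun t => term h (Y t, Z t) ^+ 2) = (fun t => dotv (sl_b G H q h) g ^+ 2 *
    (slice_ind H q h (Y t) * resid G H q h (Y t) (X t) ^+ 2)).
  by apply/funext => t; rewrite residZ /term !exprMn slice_ind_sqr; ring.
rewrite ExZ// /sl_ER2 wG.
have -> : Ex P (fun t => slice_ind H q h (Y t) * resid G H q h (Y t) (X t) ^+ 2) =
   G (fun y x => slice_ind H q h y * (y - sl_muY G H q h -
       ((sl_b G H q h)^T *m (x - sl_mu G H q h)) 0 0) ^+ 2) by [].
have wh : w h != 0 by rewrite gt_eqF.
by field.
Qed.

(** * The second-moment matrix of the influence function *)

Section Variance.
Variable (IFW : T -> 'cV[R]_p).
Hypotheses (IFE : {ae P, forall t, dotv g (IFW t) = 0 /\ forall a, dotv a g = 0 ->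
   lam * dotv a (IFW t) = score (Y t) (X t) * dotv (invmx Sig *m a) (X t - mu)})
  (IF1 : forall i j, L1 P (fun t => (IFW t *m (IFW t)^T) i j)).

Let Q : 'M[R]_p := 1%:M - g *m g^T.
(** The coordinate vector projected orthogonally to [g]. As the influence function is orthogonal to
    [g], pairing it with [a i] returns its coordinate [i]. *)
Let a i : 'cV[R]_p := Q *m delta_mx i 0.
Let b i := invmx Sig *m a i.

Let aE i : a i = delta_mx i 0 - g i 0 *: g.
Proof.
rewrite /a /Q mulmxBl mul1mx -mulmxA; congr (_ - _).
apply/matrixP => k l; rewrite [l]ord1 mxE big_ord1 mulrC.
have -> : (g^T *m (delta_mx i 0 : 'cV[R]_p)) 0 0 = g i 0.
  by rewrite -/(dotv g (delta_mx i 0)) dotvC dotv_delta.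
by rewrite mxE.
Qed.

Let ag i : dotv (a i) g = 0.
Proof. by rewrite aE dotvBl dotvZl dotv_delta gg mulr1 subrr. Qed.

Let bb i : dotv (b i) (Sig *m beta) = 0.
Proof. by rewrite Sig_inv_dot; exact: perp_dir_beta. Qed.

Let QT : Q^T = Q.
Proof. by rewrite /Q linearB /= trmx1 trmx_mul trmxK. Qed.

Let bSb i j : dotv (b i) (Sig *m b j) = (Q *m invmx Sig *m Q) i j.
Proof.
have iS : (invmx Sig)^T = invmx Sig by rewrite trmx_inv (Sig_sym P Y X).
rewrite [b j]/b mulmxA mulmxV// mul1mx /b /a.
rewrite -{1}iS -dotv_mulmx -{1}QT -dotv_mulmx dotv_delta !mulmxA.
by rewrite -colE mxE.
Qed.

(** Almost surely, coordinate $i$ of the influence function is $\lambda_1^{-1} \kappa(Y, Z)\,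
    b_i^T(X - \mu)$. Each $b_i$ is $\Sigma$-orthogonal to [beta], so the expectation of a product of
    two coordinates factors into $b_i^T \Sigma b_j$ and $E\,\kappa^2$. *)
Lemma ASV_E : \matrix_(i, j) Ex P (fun t => (IFW t *m (IFW t)^T) i j) =
  (lam ^+ 2)^-1 *:
    ((\sum_(h < H) w h * dotv (sl_b G H q h) g ^+ 2 * sl_ER2 G H q h) *:
     (Q *m invmx Sig *m Q)).
Proof.
have kx i : {ae P, forall t, IFW t i 0 = lam^-1 * (kappa (Y t, Z t) * xi (b i) t)}.
  apply: filterS IFE => t [gI aI].
  have := aI _ (ag i); rewrite scoreE aE dotvBl dotvZl gI mulr0 subr0 dotv_delta -aE.
  by move=> <-; rewrite mulKf// gt_eqF.
have xx i j : {ae P, forall t, (IFW t *m (IFW t)^T) i j =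
   (lam ^+ 2)^-1 * (kappa (Y t, Z t) ^+ 2 * (xi (b i) t * xi (b j) t))}.
  apply: filterS2 (kx i) (kx j) => t ti tj.
  by rewrite mxE big_ord1 mxE ti tj; field; rewrite gt_eqF.
have mk2 : measurable_fun setT (fun z => kappa z ^+ 2) by exact: measurable_funX.
have L2k : L2 P (fun t => kappa (Y t, Z t)) by apply: L2_sum => h; exact: L2term.
have mk : measurable_fun setT (fun t => kappa (Y t, Z t)) by case: L2k.
have mx i j : measurable_fun setT
    (fun t => (lam ^+ 2)^-1 * (kappa (Y t, Z t) ^+ 2 * (xi (b i) t * xi (b j) t))).
  apply: measurable_funM => //; apply: measurable_funM; first exact: measurable_funX.
  by apply: measurable_funM; exact: (L2xi _).1.
have LL i j := ae_eq_Ex P _ _ (IF1 i j) (mx i j) (xx i j).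
have l0 : lam ^+ 2 != 0 by rewrite expf_neq0// gt_eqF.
(* Square integrability of [kappa] and of the [xi] would not give this; it is inherited from the
   existence of the asymptotic variance. *)
have L i j : L1 P (fun t => kappa (Y t, Z t) ^+ 2 * (xi (b i) t * xi (b j) t)).
  have := L1Z P (lam ^+ 2) _ (LL i j).1; congr (L1 P _); apply/funext => t.
  by rewrite mulVKf.
apply/matrixP => i j; rewrite mxE (LL i j).2 ExZ// mxE [in RHS]mxE; congr (_ * _).
rewrite -bSb -Ex_kappa2 mulrC.
apply: (@Ex_g_xixi R d T p P Y X eps f beta mX meps mf X2 posdef beta0 Yf indep lin cvar
  (fun z => kappa z ^+ 2)) => //.
- exact: L2k.2.
- by have := L i i; congr (L1 P _); apply/funext => t; rewrite expr2.
- by have := L j j; congr (L1 P _); apply/funext => t; rewrite expr2.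
Qed.
End Variance.
End Direction.
End Influence.

Theorem theorem3 (R : realType) (d : measure_display) (T : measurableType d)
  (P : probability T R) (p H : nat)
  (Y : T -> R) (X : T -> 'cV[R]_p) (eps : T -> R) (f : R -> R -> R)
  (beta : 'cV[R]_p) (w : 'I_H -> R)
  (gam1 : expop R p -> 'cV[R]_p) (sl : expop R p -> nat -> R)
  (lam1 : R) (IF : R -> 'cV[R]_p -> 'cV[R]_p) :
  (* measurability and second moments *)
  measurable_fun setT Y ->
  (forall i, measurable_fun setT (fun t => X t i 0)) ->
  measurable_fun setT eps ->
  measurable_fun setT (fun z : R * R => f z.1 z.2) ->
  P.-integrable setT (fun t => (Y t ^+ 2)%:E) ->
  (forall i, P.-integrable setT (fun t => (X t i 0 ^+ 2)%:E)) ->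
  (* positive definite covariance of X *)
  (forall v : 'cV[R]_p, v != 0 ->
     0 < (v^T *m law_cov P Y X *m v) 0 0) ->
  (* single-index model *)
  beta != 0 ->
  (forall t, Y t = f ((beta^T *m X t) 0 0) (eps t)) ->
  indep_vec P eps X ->
  P.-integrable setT (EFin \o eps) ->
  (\int[P]_t (eps t)%:E = 0)%E ->
  (* (i) linearity condition *)
  (forall b : 'cV[R]_p, exists a0 a1 : R,
     is_condexp P (fun t => (beta^T *m X t) 0 0) (fun t => (b^T *m X t) 0 0)
       (fun z => a0 + a1 * z)) ->
  (* (ii) constant conditional variance *)
  (exists (m : R -> 'cV[R]_p) (V : 'M[R]_p),
     (forall i, is_condexp P (fun t => (beta^T *m X t) 0 0)
                  (fun t => X t i 0) (fun z => m z i 0)) /\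
     (forall i j, is_condexp P (fun t => (beta^T *m X t) 0 0)
        (fun t => (X t i 0 - m ((beta^T *m X t) 0 0) i 0) *
                  (X t j 0 - m ((beta^T *m X t) 0 0) j 0))
        (fun _ => V i j))) ->
  (* slicing of G *)
  (forall h, 0 < w h) ->
  valid_slicing (law_exp P Y X) H (sl (law_exp P Y X)) w ->
  (forall h, sl_Sigma (law_exp P Y X) H (sl (law_exp P Y X)) h \in unitmx) ->
  (* gamma_1(G) and lambda_1 *)
  0 < lam1 ->
  top_unit_eigvec (swar (law_exp P Y X) H (sl (law_exp P Y X))) lam1
    (gam1 (law_exp P Y X)) ->
  (* IF is the influence function of gamma_1 at G *)
  {ae P, forall t,
     (\forall e \near 0^'+,
        valid_slicing (mixexp (law_exp P Y X) e (Y t) (X t))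
          H (sl (mixexp (law_exp P Y X) e (Y t) (X t))) w /\
        exists l, top_unit_eigvec
          (swar (mixexp (law_exp P Y X) e (Y t) (X t)) H
                (sl (mixexp (law_exp P Y X) e (Y t) (X t)))) l
          (gam1 (mixexp (law_exp P Y X) e (Y t) (X t)))) /\
     ((fun e => e^-1 *: (gam1 (mixexp (law_exp P Y X) e (Y t) (X t))
                          - gam1 (law_exp P Y X)))
        @ 0^'+ --> IF (Y t) (X t))} ->
  (* the asymptotic variance exists *)
  (forall i j, P.-integrable setT
     (fun t => ((IF (Y t) (X t) *m (IF (Y t) (X t))^T) i j)%:E)) ->
  let G := law_exp P Y X in
  let q := sl G in
  let g := gam1 G in
  let Pm := g *m g^T in
  \matrix_(i, j) Rintegral P setT
      (fun t => ((IF (Y t) (X t) *m (IF (Y t) (X t))^T) i j)) =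
  (lam1 ^+ 2)^-1 *:
    ((\sum_(h < H) w h * (((sl_b G H q h)^T *m g) 0 0) ^+ 2 * sl_ER2 G H q h) *:
     ((1%:M - Pm) *m invmx (law_cov P Y X) *m (1%:M - Pm))).
Proof.
move=> mY mX meps mf Y2 X2 posdef beta0 Yf indep _ _ lin cvar w0 V uS lam0 gE ifE ifI G q g Pm.
apply: (ASV_E P Y X eps f beta mY mX meps mf Y2 X2 posdef beta0 Yf indep lin cvar
  H w q g lam1 w0 V uS lam0 gE (fun t => IF (Y t) (X t)) _ ifI).
(* At almost every sample point the component along [g] and the components orthogonal to [g] are
   determined separately. *)
apply: filterS ifE => t [nr cv].
have V' : \forall e \near 0^'+, valid_slicing (mixexp G e (Y t) (X t)) H
    (sl (mixexp G e (Y t) (X t))) w by apply: filterS nr => e [].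
have eig : \forall e \near 0^'+, exists l, top_unit_eigvec
    (swar (mixexp G e (Y t) (X t)) H (sl (mixexp G e (Y t) (X t)))) l
    (gam1 (mixexp G e (Y t) (X t))) by apply: filterS nr => e [].
split => [|a ag].
  exact: (IF_dot_dir P Y X H q g lam1 gE _ _ _ _ _ eig cv).
exact: (IF_perp P Y X eps f beta mY mX meps mf Y2 X2 posdef beta0 Yf indep lin cvar
  H w q g lam1 w0 V uS lam0 gE _ _ _ _ _ V' eig cv).
Qed.
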